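(* Let $(X,C)$ be a strongly ordered separable Banach space. Let $F_0:X\to X$ be a compact $C^1$-map such that for every $x\in X$ the Fréchet derivative $DF_0(x)$ is strongly positive, i.e. $DF_0(x)v\gg 0$ whenever $v>0$. Assume that $F_0$ is pointwise dissipative, with an attractor $A$. Then the set $$S_0:=\{x\in X:\ \lambda_{\max}(x,F_0)>0\}$$ is shy in $X$. In particular, if $X=\mathbb{R}^d$, then $S_0$ has Lebesgue measure zero in $\mathbb{R}^d$; hence $F_0$ cannot have observable chaos.
   Context: Order: A cone $C$ in a Banach space $(X,\|\cdot\|)$ is a closed convex subset with $\lambda C\subset C$ for all $\lambda>0$ and $C\cap(-C)=\{0\}$. $(X,C)$ is a strongly ordered Banach space if $C$ has nonempty interior $\mathrm{Int}\,C$. Write $x\le y$ if $y-x\in C$, $x<y$ if $y-x\in C\setminus\{0\}$, $x\ll y$ if $y-x\in \mathrm{Int}\,C$ (reversed signs in the usual way). Maps: A map is compact if it is continuous and sends bounded sets to relatively compact sets. A set $B$ attracts a set $S$ under $h$ if $\sup_{x\in S}\mathrm{dist}(h^n x,B)\to 0$ as $n\to\infty$. A continuous map $h:X\to X$ is pointwise dissipative if there is a bounded set $B\subset X$ attracting each point of $X$. An attractor of $h$ is an invariant set $A$ ($h(A)=A$) that is the maximal compact invariant set and attracts each bounded subset of $X$. Largest Lyapunov exponent: for a $C^1$-map $h:X\to X$ and $x\in X$, $$\lambda_{\max}(x,h)=\liminf_{n\to+\infty}\frac{\log\|Dh^n(x)\|}{n},$$ with the convention $\log 0=-\infty$. Observable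 chaos: a $C^1$-map on a finite-dimensional space has observable chaos if $\lambda_{\max}(\cdot,h)>0$ on a set of positive Lebesgue measure. Shyness: a Borel subset $W\subset X$ is shy if there is a nonzero finite compactly supported Borel measure $\mu$ on $X$ with $\mu(W+x)=0$ for every $x\in X$. *)

(* Defs.v *)
From HB Require Import structures.
From mathcomp Require Import all_boot all_order all_algebra.
From mathcomp Require Import all_classical all_reals all_analysis.

Set Implicit Arguments.
Unset Strict Implicit.
Unset Printing Implicit Defensive.

Import Order.TTheory GRing.Theory Num.Theory.
Import numFieldNormedType.Exports.

Local Open Scope classical_set_scope.
Local Open Scope ring_scope.

Definition separable (T : topologicalType) : Prop :=
  exists2 D : set T, countable D & dense D.

Section Order.
Context {R : realType} {X : normedModType R}.
Implicit Types (C : set X) (x y : X).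

Definition is_cone C : Prop :=
  [/\ closed C,
      convex_set C,
      (forall l : R, 0 < l -> [set l *: v | v in C] `<=` C) &
      C `&` [set - v | v in C] = [set 0]].

Definition strong_cone C : Prop := is_cone C /\ interior C !=set0.

Definition cone_lt C x y : Prop := (C `\ 0) (y - x).

Definition cone_ll C x y : Prop := interior C (y - x).

Definition strongly_positive C (L : X -> X) : Prop :=
  forall v, cone_lt C 0 v -> cone_ll C 0 (L v).

End Order.

Section Calculus.
Context {R : realType} {X : normedModType R}.
Implicit Types (h L : X -> X) (x : X).
Local Open Scope ereal_scope.

(* Extended-real valued: +oo exactly when the linear map L is unbounded. *)
Definition opnorm L : \bar R :=
  ereal_sup [set `|L v|%:E | v in [set v : X | (`|v| <= 1)%R]].

Definition C1_map h : Prop :=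
  (forall x, differentiable h x) /\
  (forall x, opnorm (fun v => 'd h y v - 'd h x v)%R @[y --> x] --> 0).

(* lne 0 = -oo; the term n = 0 is irrelevant to the liminf. *)
Definition lambda_max x h : \bar R :=
  limn_einf (fun n : nat => lne (opnorm ('d (iter n h) x)) * (n%:R^-1)%:E).

End Calculus.

Section Dynamics.
Context {R : realType} {X : normedModType R}.
Implicit Types (h : X -> X) (A B S : set X) (x : X).

Definition compact_map h : Prop :=
  continuous h /\ (forall B, bounded_set B -> precompact (h @` B)).

Local Open Scope ereal_scope.

Definition set_dist x B : \bar R := ereal_inf [set `|x - b|%:E | b in B].

(* The supremum is taken in [0, +oo], so that it is 0 for S = set0, whereas
   ereal_sup set0 = -oo. *)
Definition attracts h B S : Prop :=
  maxe 0 (ereal_sup [set set_dist (iter n h x) B | x in S]) @[n --> \oo] --> 0.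

Definition pointwise_dissipative h : Prop :=
  continuous h /\
  (exists2 B, bounded_set B & forall x, attracts h B [set x]).

Definition is_attractor h A : Prop :=
  [/\ compact A, h @` A = A,
      (forall K, compact K -> h @` K = K -> K `<=` A) &
      (forall S, bounded_set S -> attracts h A S)].

End Dynamics.

Section Shyness.
Context {R : realType} {X : normedModType R}.
Local Open Scope ereal_scope.

Local Notation borel := (g_sigma_algebraType (@open X)).

Definition shy (W : set X) : Prop :=
  measurable (W : set borel) /\
  exists mu : {finite_measure set borel -> \bar R},
    [/\ mu setT != 0,
        (exists2 K : set borel, compact (K : set X) & mu (~` K) = 0) &
        (forall x : X, mu [set (w + x)%R | w in W] = 0)].

End Shyness.

Section Lebesgue.
Context {R : realType} {d : nat}.
Implicit Types (a b : 'rV[R]_d) (E : set 'rV[R]_d).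

Definition box a b : set 'rV[R]_d :=
  [set x | forall i, a ord0 i <= x ord0 i <= b ord0 i].

Definition box_volume a b : R := \prod_(i < d) (b ord0 i - a ord0 i).

Local Open Scope ereal_scope.

(* Lebesgue outer measure: infimum of the total volumes of the covers by at
   most countably many boxes (those with index in I).  It is the Lebesgue
   measure on its Caratheodory-measurable sets, and the sets of Lebesgue
   measure zero are those of outer measure 0. *)
Definition lebesgue_outer E : \bar R :=
  ereal_inf [set v | exists (I : set nat) (a b : nat -> 'rV[R]_d),
    [/\ (forall k i, (a k ord0 i <= b k ord0 i)%R),
        E `<=` \bigcup_(k in I) box (a k) (b k) &
        v = \esum_(k in I) (box_volume (a k) (b k))%:E]].

(* phi identifies the finite-dimensional space X with R^d; X = R^d with an
   arbitrary norm is covered, phi being the identity on coordinates. *)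
Definition observable_chaos (X : normedModType R) (phi : 'rV[R]_d -> X)
    (h : X -> X) : Prop :=
  exists E, [/\ caratheodory_measurable lebesgue_outer E,
                0 < lebesgue_outer E &
                forall u, E u -> 0 < lambda_max (phi u) h].

End Lebesgue.

(* Main.v *)
(* Fix [v] in the interior of the cone [C] and write [J n x] for the derivative
   of the [n]-th iterate at [x].  The growth of [J n x] is read off
   [J n x v], and then averaged over lines of direction [v].

   Compactness of the derivatives and strong positivity give [c > 0] such that,
   once the orbit of [x] has entered a fixed compact set,
   [J (n + 2) x v >= c * |J n x| * v] at every time [n] with
   [|J n x| <= |J (n + 1) x|].  If [lambda_max x > 0] such times never stop and
   [|J n x|] is exponentially large at them.  On the other hand, the curve
   [s |-> F^n (x + s v)] increases and stays in a bounded set, because of the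
   attractor, so the set of the [s] at which its derivative exceeds [kappa * v]
   has measure [O(1 / kappa)], uniformly in [n].  By Borel-Cantelli, almost every
   point of the line has a nonpositive exponent: the uniform measure on the
   segment [0, v] witnesses shyness.

   The estimate [O(1 / kappa)] is obtained directly in [R^d], for a direction [v]
   with integer components, by counting the cells of a fine grid: this avoids
   Fubini's theorem, and a concave functional avoids Hahn-Banach. *)

From HB Require Import structures.
Require Import Defs.
From mathcomp Require Import all_boot all_order all_algebra.
From mathcomp Require Import all_classical all_reals all_analysis.
From mathcomp Require Import measurable_realfun zify ring lra.

Set Implicit Arguments.
Unset Strict Implicit.
Unset Printing Implicit Defensive.

Import Order.TTheory GRing.Theory Num.Theory.
Import numFieldNormedType.Exports.
Local Open Scope classical_set_scope.
Local Open Scope ring_scope.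

(** * Cones *)

Section Cone.
Context {R : realType} {X : normedModType R}.
Implicit Types (C : set X) (x y v w : X).

Lemma coneZ C (l : R) x : is_cone C -> 0 < l -> C x -> C (l *: x).
Proof. by move=> [_ _ CZ _] l0 Cx; apply: (CZ l l0); exists x. Qed.

Lemma coneD C x y : is_cone C -> C x -> C y -> C (x + y).
Proof.
move=> Ccone Cx Cy; have [_ Cconv _ _] := Ccone.
have h0 : (0 : R) <= 2^-1 by lra.
have h1 : (2^-1 : R) <= 1 by lra.
have := Cconv x y (Itv01 h0 h1); rewrite !inE => /(_ Cx Cy) Cxy.
have -> : x + y = 2 *: ((2^-1 : R) *: x + (1 - 2^-1) *: y).
  by rewrite scalerDr !scalerA; congr (_ + _); rewrite -[LHS]scale1r;
    congr (_ *: _); field.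
by apply: coneZ => //.
Qed.

Lemma cone0 C : is_cone C -> C 0.
Proof.
move=> [_ _ _ C0]; have : (C `&` [set - v | v in C]) 0 by rewrite C0.
by case.
Qed.

Lemma coneN C x : is_cone C -> C x -> C (- x) -> x = 0.
Proof.
move=> [_ _ _ C0] Cx CNx.
have : (C `&` [set - v | v in C]) x by split=> //; exists (- x) => //; rewrite opprK.
by rewrite C0.
Qed.

Lemma coneZ_ge0 C (l : R) x : is_cone C -> 0 <= l -> C x -> C (l *: x).
Proof.
move=> Cc; rewrite le_eqVlt => /orP[/eqP<- _|l0]; last exact: coneZ.
by rewrite scale0r; exact: cone0.
Qed.

Lemma interior_coneP C v : interior C v ->
  exists2 r : R, 0 < r & forall w, `|w| <= r -> C (v + w).
Proof.
move=> /nbhs_normP[r /= r0 rC]; exists (r / 2); first by rewrite divr_gt0.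
move=> w wr; apply: rC; rewrite /= opprD addNKr normrN.
by apply: le_lt_trans wr _; lra.
Qed.

(** Homogeneous form of the ball condition: a perturbation [w] is absorbed by [|w| / r] times [v].
    Error terms below are absorbed in this way. *)
Lemma interior_cone_norm C v (r : R) : is_cone C -> 0 < r ->
  (forall w, `|w| <= r -> C (v + w)) -> forall w, C ((`|w| / r) *: v + w).
Proof.
move=> Cc r0 rC w; have [->|w0] := eqVneq w 0.
  by rewrite normr0 mul0r scale0r addr0; exact: cone0.
have nw : 0 < `|w| by rewrite normr_gt0.
have -> : (`|w| / r) *: v + w = (`|w| / r) *: (v + (r / `|w|) *: w).
  rewrite scalerDr scalerA; congr (_ + _); rewrite -[LHS]scale1r; congr (_ *: _).
  by field; rewrite !gt_eqF.
apply: coneZ => //; first exact: divr_gt0.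
apply: rC; rewrite normrZ ger0_norm ?divfK ?gt_eqF// ltW//.
exact: divr_gt0.
Qed.

Lemma interior_coneZ C v (l : R) : is_cone C -> 0 < l ->
  interior C v -> interior C (l *: v).
Proof.
move=> Cc l0 /interior_coneP[r r0 rC]; apply/nbhs_normP.
exists (l * r) => /=; first exact: mulr_gt0.
move=> y /=; rewrite distrC => yr.
have -> : y = l *: (v + l^-1 *: (y - l *: v)).
  by rewrite scalerDr scalerA divff ?gt_eqF// scale1r addrC subrK.
apply: coneZ => //; apply: rC.
by rewrite normrZ gtr0_norm ?invr_gt0// mulrC ler_pdivrMr// mulrC ltW.
Qed.

(** If [0] were interior, [C] would be the whole space, against [C] meeting [- C] only at [0]. *)
Lemma interior_cone_neq0 C v : is_cone C -> interior C v ->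
  (exists x : X, x != 0) -> v != 0.
Proof.
move=> Cc vC [x x0]; apply/eqP => v0; move/eqP: x0; apply.
have [r r0 rC] := interior_coneP vC.
have H w : C w.
  by have := interior_cone_norm Cc r0 rC w; rewrite v0 scaler0 add0r.
exact: coneN Cc (H _) (H _).
Qed.

(* [Phi y] is the largest [l] with [l *: v] below [y]: it plays the part of a
   positive functional, being monotone, and additive along [v]. *)
Lemma cone_functional C v : is_cone C -> interior C v -> v != 0 ->
  exists (Phi : X -> R) (M : R),
    [/\ 0 <= M, forall y, `|Phi y| <= M * `|y| &
        forall y y' (l : R), C (y' - y - l *: v) -> Phi y + l <= Phi y'].
Proof.
move=> Cc vC v0; have [r r0 rC] := interior_coneP vC.
pose S y := [set l : R | C (y - l *: v)].
have CNv : ~ C (- v).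
  move=> CNv; move/eqP: v0; apply; apply: coneN Cc _ CNv.
  by have := rC 0; rewrite normr0 addr0; apply; exact: ltW.
(* A larger [l] would put a positive multiple of [- v] in [C]. *)
have Sub y : ubound (S y) (`|y| / r).
  move=> l Sl; rewrite leNgt; apply/negP => lt_l.
  have := interior_cone_norm Cc r0 rC (- y); rewrite normrN => /(coneD Cc Sl).
  have -> : y - l *: v + ((`|y| / r) *: v - y) = (l - `|y| / r) *: (- v).
    by rewrite addrC addrA subrK -scalerBl scalerN -scaleNr opprB.
  move=> /(coneZ Cc (l := (l - `|y| / r)^-1)).
  rewrite invr_gt0 subr_gt0 => /(_ lt_l).
  by rewrite scalerA mulVf ?scale1r ?gt_eqF ?subr_gt0.
have Slb y : S y (- (`|y| / r)).
  by rewrite /S /= scaleNr opprK addrC; exact: interior_cone_norm.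
have Ssup y : has_sup (S y) by split; [eexists; exact: Slb|eexists; exact: Sub].
exists (fun y => sup (S y)), r^-1; split; first by rewrite invr_ge0 ltW.
  move=> y; rewrite ler_norml mulrC; apply/andP; split.
    by apply: ub_le_sup => //; have [] := Ssup y.
  by apply: ge_sup => //; have [] := Ssup y.
move=> y y' l Cl; rewrite -lerBrDr; apply: ge_sup; first by have [] := Ssup y.
move=> k Sk; rewrite lerBrDr; apply: ub_le_sup; first by have [] := Ssup y'.
rewrite /S /=; have := coneD Cc Sk Cl.
congr C; rewrite addrACA [y + _]addrC subrK scalerDl opprD.
by rewrite [- (k *: v) - _]addrC addrC.
Qed.

End Cone.

(** * Differential calculus *)

Section Calculus.
Context {R : realType} {X : normedModType R}.
Implicit Types (C : set X) (h : X -> X) (x y v w e : X).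

Lemma differentiable_estimate h x (eps : R) : differentiable h x -> 0 < eps ->
  exists2 del : R, 0 < del &
    forall w, `|w| <= del -> `|h (x + w) - h x - 'd h x w| <= eps * `|w|.
Proof.
move=> hx e0; have [_ /eqaddoP /(_ eps e0)] := proj1 (diff_locallyP x h) hx.
move=> /nbhs_normP[r /= r0 rP]; exists (r / 2); first exact: divr_gt0.
move=> w wr; have /= := rP w; rewrite sub0r normrN.
rewrite -[(_ - (_ + _)) w]/(h (w + x) - (h x + 'd h x w)) opprD addrA [w + x]addrC.
by apply; apply: le_lt_trans wr _; lra.
Qed.

Lemma closed_approx C y : closed C ->
  (forall eps : R, 0 < eps -> exists2 z, C z & `|y - z| < eps) -> C y.
Proof.
move=> cC H; apply: cC => B /nbhs_normP[r /= r0 rB].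
by have [z Cz yz] := H r r0; exists z; split=> //; apply: rB.
Qed.

(* The set of the [s] for which the inequality holds on [0, s], with [kappa]
   replaced by [kappa - eta], is closed, and cannot have a supremum below [del]
   because [eta *: e] absorbs the error of the differential. *)
Lemma cone_mean_value C h e x v (kappa del : R) : is_cone C -> interior C e ->
  (forall y, differentiable h y) -> 0 <= del ->
  (forall s : R, 0 <= s <= del -> C ('d h (x + s *: v) v - kappa *: e)) ->
  C (h (x + del *: v) - h x - (del * kappa) *: e).
Proof.
move=> Cc eC hd del0 Hd; have [r r0 rC] := interior_coneP eC.
have [cC _ _ _] := Cc.
suff key (eta : R) : 0 < eta ->
    C (h (x + del *: v) - h x - (del * (kappa - eta)) *: e).
  apply: closed_approx cC _ => eps eps0.
  have d0 : 0 < del * `|e| + 1 by rewrite ltr_wpDl// mulr_ge0.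
  (* This [eta] costs [del * eta * |e| < eps]; the [+ 1] avoids dividing by zero. *)
  exists (h (x + del *: v) - h x - (del * (kappa - eps / (del * `|e| + 1))) *: e).
    by apply: key; exact: divr_gt0.
  rewrite opprB addrC addrA subrK -scalerBl normrZ.
  rewrite (_ : _ - _ = - (del * (eps / (del * `|e| + 1)))); last by ring.
  rewrite normrN ger0_norm; last by rewrite mulr_ge0// divr_ge0// ltW.
  rewrite [ltLHS](_ : _ = del * `|e| * eps / (del * `|e| + 1)); last by ring.
  by rewrite ltr_pdivrMr// mulrC ltr_pM2l// ltrDl.
move=> eta0.
pose z s := h (x + s *: v) - h x - (s * (kappa - eta)) *: e.
have zc : continuous z.
  move=> s; rewrite /z; apply: cvgB; last first.
    by apply: cvgZr_tmp; apply: cvgMr_tmp; exact: cvg_id.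
  apply: cvgB; last exact: cvg_cst.
  apply: (@continuous_comp _ _ _ (fun s : R => x + s *: v) h).
    by apply: cvgD; [exact: cvg_cst|apply: cvgZr_tmp; exact: cvg_id].
  exact: differentiable_continuous.
pose T := [set s : R | 0 <= s <= del /\ C (z s)].
have T0 : T 0.
  split; first by rewrite lexx.
  by rewrite /z mul0r !scale0r addr0 subrr subr0; exact: cone0.
have Tub : has_ubound T by exists del => s [/andP[]].
have cT : closed T.
  rewrite (_ : T = `[0, del]%classic `&` z @^-1` C); last first.
    by apply/seteqP; split=> s /=; rewrite in_itv.
  apply: closedI; first exact: interval_closed.
  by apply: preimage_closed => // s _; exact: zc.
have [/andP[s0 sd] Cs] : T (sup T).
  by apply: cT; apply: closure_sup => //; exists 0.
have [sE|sD] := eqVneq (sup T) del; first by move: Cs; rewrite sE.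
have {sD} sd' : sup T < del by rewrite lt_neqAle sD.
exfalso; set s := sup T in s0 sd Cs sd'.
have v0 : 0 < `|v| + 1 by rewrite ltr_wpDl.
(* With this tolerance the error over a step [t] has norm at most [t * eta * r], which
   [(t * eta) *: e] absorbs; the [+ 1] covers [v = 0]. *)
have er0 : 0 < eta * r / (`|v| + 1) by rewrite divr_gt0// mulr_gt0.
have [d d0 dP] := differentiable_estimate (hd (x + s *: v)) er0.
pose t := Num.min (del - s) (d / (`|v| + 1)).
have t0 : 0 < t by rewrite lt_min subr_gt0 sd' divr_gt0.
have td : t <= del - s by rewrite ge_min lexx.
have tv : t * `|v| <= d.
  have : t <= d / (`|v| + 1) by rewrite ge_min lexx orbT.
  rewrite ler_pdivlMr// => /(le_trans _); apply.
  by rewrite ler_pM2l// lerDl.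
have : T (s + t).
  split; first by apply/andP; split; [rewrite addr_ge0// ltW|rewrite -lerBrDl].
  have := dP (t *: v); rewrite normrZ gtr0_norm// => /(_ tv).
  set o := _ - _ - _ => oP.
  have Co : C ((t * eta) *: e + o).
    have := coneD Cc (coneZ_ge0 (l := t * eta - `|o| / r) Cc _ (interior_subset eC))
      (interior_cone_norm Cc r0 rC o).
    rewrite addrA -scalerDl subrK; apply.
    rewrite subr_ge0 ler_pdivrMr//; apply: le_trans oP _.
    rewrite [leLHS](_ : _ = t * eta * r * (`|v| / (`|v| + 1))); last by ring.
    rewrite ger_pMr; last by rewrite !mulr_gt0.
    by rewrite ler_pdivrMr// mul1r lerDl.
  have s01 : 0 <= s <= del by rewrite s0 sd.
  have := coneD Cc (coneD Cc Cs (coneZ_ge0 Cc (ltW t0) (Hd s s01))) Co.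
  set c := 'd h _ v; have -> : o = h (x + s *: v + t *: v) - h (x + s *: v) - t *: c.
    by rewrite /c -linearZ.
  rewrite /z; congr C; rewrite scalerBr scalerA.
  have -> : (s + t) * (kappa - eta) = s * (kappa - eta) + (t * kappa - t * eta) by ring.
  have -> : h (x + (s + t) *: v) = h (x + s *: v + t *: v) by rewrite scalerDl addrA.
  rewrite [(_ + (_ - _)) *: e]scalerDl [(t * kappa - _) *: e]scalerBl !opprD !opprK !addrA.
  by rewrite [LHS](ACl (7*2*3*5*6*(1*8)*(4*9)))%AC /= !subrr !addr0.
move=> Tst; have := ub_le_sup Tub Tst.
by rewrite gerDl leNgt t0.
Qed.
End Calculus.

(** * Operator norms and derivatives of iterates *)

Section OperatorNorm.
Context {R : realType} {X : normedModType R}.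
Implicit Types (h L : X -> X) (x y v w : X).

Lemma lt_opnorm L (c : R) : (c%:E < opnorm L)%E ->
  exists2 v, `|v| <= 1 & c < `|L v|.
Proof. by move=> /ereal_sup_gt[_ [v v1 <-]]; rewrite lte_fin; exists v. Qed.

Lemma opnorm_gt L (c : R) v : `|v| <= 1 -> c < `|L v| -> (c%:E < opnorm L)%E.
Proof.
move=> v1 cv; apply: (@lt_le_trans _ _ `|L v|%:E); first by rewrite lte_fin.
by apply: ereal_sup_ubound; exists v.
Qed.

Lemma opnorm_ge0 L : (0 <= opnorm L)%E.
Proof.
apply: (@le_trans _ _ `|L 0|%:E); first by rewrite lee_fin.
by apply: ereal_sup_ubound; exists 0 => //=; rewrite normr0.
Qed.

Lemma opnorm_le L (c : R) : (forall v, `|v| <= 1 -> `|L v| <= c) ->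
  (opnorm L <= c%:E)%E.
Proof. by move=> H; apply: ge_ereal_sup => _ [v v1 <-]; rewrite lee_fin H. Qed.

Lemma le_opnorm L (c : R) v : scalable L -> (opnorm L <= c%:E)%E ->
  `|L v| <= c * `|v|.
Proof.
move=> LZ Lc; have [->|v0] := eqVneq v 0.
  by rewrite -[X in L X](scale0r 0) LZ scale0r !normr0 mulr0.
have nv : 0 < `|v| by rewrite normr_gt0.
have : (`|L (`|v|^-1 *: v)|%:E <= opnorm L)%E.
  apply: ereal_sup_ubound; exists (`|v|^-1 *: v) => //=.
  by rewrite normrZ normfV normr_id mulVf// gt_eqF.
move=> /le_trans => /(_ _ Lc); rewrite lee_fin LZ normrZ normfV normr_id.
by rewrite mulrC ler_pdivrMr.
Qed.

Lemma opnorm_fin_num (L : {linear X -> X}) : continuous L ->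
  opnorm L \is a fin_num.
Proof.
move=> cL; rewrite ge0_fin_numE ?opnorm_ge0//.
have /cvgr_norm_lt /(_ _ ) := cL 0; rewrite linear0 normr0 => /(_ 1 ltr01).
move=> /nbhs_normP[r /= r0 rP]; apply: (@le_lt_trans _ _ (2 / r)%:E); last exact: ltry.
apply: opnorm_le => v v1.
have r2 : `|r / 2| = r / 2 by rewrite ger0_norm; lra.
have /rP : ball_ Num.Def.normr 0 r ((r / 2) *: v).
  by rewrite /ball_ /= sub0r normrN normrZ r2; nra.
by rewrite /= linearZ normrZ r2 ler_pdivlMr// => ?; nra.
Qed.

(** Convergence in the extended reals makes the norm of the difference finite near [x]; homogeneity
    then extends the bound from the unit ball to all [v]. *)
Lemma C1_map_estimate h x (eps : R) : C1_map h -> 0 < eps ->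
  \forall y \near x, forall v, `|'d h y v - 'd h x v| <= eps * `|v|.
Proof.
move=> [_ /(_ x) /fine_cvgP[xfin /cvgrPdist_le /(_ eps)]] /[apply].
rewrite !near_simpl => H; near=> y => v.
apply: (@le_opnorm (fun v => 'd h y v - 'd h x v)).
  by move=> k u; rewrite scalerBr; congr (_ - _); exact: linearZ.
rewrite -[opnorm _]fineK ?lee_fin; last by near: y.
rewrite -[leLHS]ger0_norm ?fine_ge0 ?opnorm_ge0//.
by rewrite -[X in `|X|]opprK normrN -sub0r; near: y.
Unshelve. all: by end_near. Qed.

(** Joint continuity of the derivative in base point and vector: [z k] is eventually bounded, so
    closeness in operator norm suffices. The filter is arbitrary because both neighbourhood filters
    and ultrafilters occur below. *)
Lemma cvg_diff h (T : Type) (F : set_system T) (y z : T -> X) (y0 z0 : X) :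
  Filter F -> C1_map h -> y @ F --> y0 -> z @ F --> z0 ->
  'd h (y k) (z k) @[k --> F] --> 'd h y0 z0.
Proof.
move=> FF hC1 yc zc; have [hd _] := hC1.
have zc' : 'd h y0 (z k) @[k --> F] --> 'd h y0 z0.
  apply: (cvg_comp _ _ zc); exact: diff_continuous (hd y0) z0.
suff H : ('d h (y k) (z k) - 'd h y0 (z k)) @[k --> F] --> 0.
  have -> : (fun k => 'd h (y k) (z k)) =
      (fun k => 'd h (y k) (z k) - 'd h y0 (z k) + 'd h y0 (z k)).
    by apply/funext => k; rewrite subrK.
  by rewrite -[X in _ --> X]add0r; exact: cvgD H zc'.
apply/cvgr0Pnorm_le => eps eps0.
have e0 : 0 < eps / (`|z0| + 1) by rewrite divr_gt0// ltr_wpDl.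
have Hy : \forall k \near F, forall v,
    `|'d h (y k) v - 'd h y0 v| <= eps / (`|z0| + 1) * `|v|.
  exact: yc (C1_map_estimate y0 hC1 e0).
have Hz : \forall k \near F, `|z k| <= `|z0| + 1.
  have /cvgr_norm_le := zc; apply.
  by rewrite ltrDl.
near=> k.
have Hk : forall v, `|'d h (y k) v - 'd h y0 v| <= eps / (`|z0| + 1) * `|v|.
  by near: k.
apply: le_trans (Hk _) _.
by rewrite mulrAC ler_pdivrMr ?ltr_wpDl// ler_pM2l//; near: k.
Unshelve. all: by end_near. Qed.

Lemma differentiable_iter h n x : C1_map h -> differentiable (iter n h) x.
Proof.
move=> [hd _]; elim: n => [|n IH].
  by have [] := is_diff_id x.
exact: (@differentiable_comp _ _ _ _ (iter n h) h).
Qed.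

Lemma diff_iterS h n x v : C1_map h ->
  'd (iter n.+1 h) x v = 'd h (iter n h x) ('d (iter n h) x v).
Proof.
move=> hC1; have [hd _] := hC1.
have := @diff_comp R X X X (iter n h) h x (differentiable_iter n x hC1) (hd _).
by move=> /(congr1 (fun f => f v)).
Qed.

Lemma continuous_iter h n : continuous h -> continuous (iter n h).
Proof.
move=> hc; elim: n => [|n IH] x /=; first exact: cvg_id.
apply: (@continuous_comp _ _ _ (iter n h) h); [exact: IH|exact: hc].
Qed.

Lemma continuous_diff_iter h n v : C1_map h ->
  continuous (fun x => 'd (iter n h) x v).
Proof.
move=> hC1; have [hd _] := hC1; elim: n => [|n IH] x.
  rewrite (_ : (fun x => _) = cst v); first exact: cvg_cst.
  apply/funext => y; rewrite (_ : iter 0 h = id)//.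
  by have [_ ->] := is_diff_id y.
under eq_fun do rewrite diff_iterS//.
apply: cvg_diff => //; last exact: IH.
apply: continuous_iter => y; exact: differentiable_continuous.
Qed.

End OperatorNorm.

(** * Uniform positivity on compact sets *)

Lemma ultra_fmap (T S : Type) (f : T -> S) (F : set_system T) :
  UltraFilter F -> UltraFilter (f @ F).
Proof.
move=> FU; split; first exact: fmap_proper_filter.
move=> G GP FG; apply/seteqP; split=> // A GA.
have [//|FnA] := in_ultra_setVsetC (f @^-1` A) FU.
have : G (A `&` ~` A) by apply: filterI => //; exact: FG.
by rewrite setICr => /filter_not_empty.
Qed.

(** An ultrafilter replaces the extraction of subsequences: several sequences converge along the
    same [U]. *)
Lemma compact_ultra_cvg (T : Type) (S : topologicalType) (K : set S)
    (U : set_system T) (f : T -> S) :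
  UltraFilter U -> compact K -> (\forall t \near U, K (f t)) ->
  exists2 p, K p & f @ U --> p.
Proof.
move=> UU; rewrite compact_ultra => KP UK.
by have [p [Kp fp]] := KP (f @ U) (ultra_fmap f UU) UK; exists p.
Qed.

Section CompactDerivative.
Context {R : realType} {X : completeNormedModType R}.
Implicit Types (C : set X) (h : X -> X) (x y v w e : X).

(* Compactness of the derivative, locally uniformly in the base point; the
   difference quotients, which lie in compact sets, approximate it. *)
Lemma diff_compact_cvg h (T : Type) (U : set_system T) (y w : T -> X) (y0 : X)
    (rho : R) : UltraFilter U -> compact_map h -> C1_map h ->
  y @ U --> y0 -> (forall k, `|w k| <= rho) ->
  cvg ('d h (y k) (w k) @[k --> U]).
Proof.
move=> UU [hc hcomp] hC1 yc wrho'; have [hd _] := hC1.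
wlog rho0 : rho wrho' / 0 < rho.
  move=> H; apply: (H (`|rho| + 1)); last by rewrite ltr_wpDl.
  by move=> k; apply: le_trans (wrho' k) _; rewrite (le_trans (ler_norm _))// lerDl.
have : cvg ('d h y0 (w k) @[k --> U]).
  apply: cauchy_cvg; apply: cauchy_exP => eps eps0.
  (* With this tolerance the difference quotients at scale [t] are within [eps / 4] of the
     derivative on the ball of radius [rho]. *)
  have e0 : 0 < eps / (4 * rho) by rewrite divr_gt0// mulr_gt0.
  have [del del0 delP] := differentiable_estimate (hd y0) e0.
  pose t := del / rho; have t0 : 0 < t by exact: divr_gt0.
  have wt k : `|t *: w k| <= del.
    by rewrite normrZ gtr0_norm// mulrAC ler_pdivrMr// ler_pM2l.
  have bB : bounded_set [set y0 + t *: w k | k in setT].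
    exists (`|y0| + del); split; first exact: num_real.
    move=> M HM _ [k _ <-]; apply: le_trans (ler_normD _ _) _.
    by apply: le_trans (ltW HM); rewrite lerD2l.
  have := hcomp _ bB; rewrite precompactE => Kc.
  have [|g _ gP] := @compact_ultra_cvg _ _ _ U (fun k => h (y0 + t *: w k)) UU Kc.
    by apply: nearW => k; apply: subset_closure; exists (y0 + t *: w k) => //; exists k.
  (* The centre of the Cauchy ball is the difference quotient formed with the limit [g]. *)
  exists (t^-1 *: (g - h y0)).
  have te : 0 < t * eps / 4 by rewrite divr_gt0// mulr_gt0.
  move/cvgrPdist_lt : gP => /(_ _ te); apply: filterS => k Hk.
  rewrite -ball_normE /=.
  have -> : t^-1 *: (g - h y0) - 'd h y0 (w k) = t^-1 *: ((g - h (y0 + t *: w k)) +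
     (h (y0 + t *: w k) - h y0 - 'd h y0 (t *: w k))).
    have -> : 'd h y0 (t *: w k) = t *: 'd h y0 (w k) by exact: linearZ.
    rewrite !addrA subrK [in RHS]scalerBr scalerA mulVf ?gt_eqF//.
    by rewrite scale1r.
  rewrite normrZ gtr0_norm ?invr_gt0// mulrC ltr_pdivrMr//.
  apply: le_lt_trans (ler_normD _ _) _.
  apply: (@lt_le_trans _ _ (t * eps / 4 + t * eps / 4)); last by nra.
  apply: ltr_leD => //; apply: le_trans (delP _ (wt k)) _.
  rewrite normrZ gtr0_norm//.
  have -> : eps / (4 * rho) * (t * `|w k|) = t * eps / 4 * (`|w k| / rho).
    by field; rewrite gt_eqF.
  by rewrite ger_pMr// ler_pdivrMr// mul1r.
move=> /cvg_ex[l lP]; apply/cvg_ex; exists l.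
suff H : ('d h (y k) (w k) - 'd h y0 (w k)) @[k --> U] --> 0.
  have -> : (fun k => 'd h (y k) (w k)) =
      (fun k => 'd h (y k) (w k) - 'd h y0 (w k) + 'd h y0 (w k)).
    by apply/funext => k; rewrite subrK.
  by rewrite -[X in _ --> X]add0r; exact: cvgD H lP.
apply/cvgr0Pnorm_le => eps eps0.
have e0 : 0 < eps / rho by exact: divr_gt0.
have : \forall k \near U, forall v, `|'d h (y k) v - 'd h y0 v| <= eps / rho * `|v|.
  exact: yc (C1_map_estimate y0 hC1 e0).
apply: filterS => k /(_ (w k)) /le_trans; apply.
by rewrite mulrAC ler_pdivrMr// ler_pM2l.
Qed.

End CompactDerivative.

Section Positivity.
Context {R : realType} {X : completeNormedModType R}.
Implicit Types (C K : set X) (h : X -> X) (x y v w e q : X).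

Lemma strongly_positive_cone C (L : {linear X -> X}) v : is_cone C ->
  strongly_positive C L -> C v -> C (L v).
Proof.
move=> Cc Lpos Cv; have [->|v0] := eqVneq v 0; first by rewrite linear0; exact: cone0.
apply: interior_subset; rewrite -[L v]subr0; apply: Lpos.
by split; rewrite subr0//; apply/eqP.
Qed.

(* Along an ultrafilter a sequence of counterexamples has a limit [q] for
   [dh y q_k], and [q +- r *: w] in [C] with [w != 0] forces [q != 0], so
   that the second derivative maps [q] to the interior of [C]. *)
Lemma uniform_positivity C h K v (r rho eps : R) : is_cone C -> interior C v ->
  compact_map h -> C1_map h -> (forall x, strongly_positive C ('d h x)) ->
  compact K -> 0 < eps ->
  exists2 c : R, 0 < c & forall y q w, K y -> `|q| <= rho -> `|w| <= 1 ->
    C (q + r *: w) -> C (q - r *: w) -> eps <= `|'d h y w| -> 0 < r ->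
    C ('d h (h y) ('d h y q) - c *: v).
Proof.
move=> Cc vC hc hC1 hpos Kc eps0; have [hd _] := hC1; have [cC _ _ _] := Cc.
apply: contrapT => /forall2NP H.
have {}H k : exists z : X * X * X, let: (y, q, w) := z in
    [/\ K y, `|q| <= rho, `|w| <= 1,
    [/\ C (q + r *: w), C (q - r *: w), eps <= `|'d h y w| & 0 < r] &
    ~ C ('d h (h y) ('d h y q) - k.+1%:R^-1 *: v)].
  have [|] := H k.+1%:R^-1; first by [].
  move=> Hk; apply: contrapT => /forallNP Hz; apply: Hk => y q w Ky qr w1 Cp Cm ew r0.
  by apply: contrapT => nC; apply: (Hz (y, q, w)).
have {H} [z zP] := choice H.
pose y k := (z k).1.1; pose q k := (z k).1.2; pose w k := (z k).2.
have {}zP k : [/\ K (y k), `|q k| <= rho, `|w k| <= 1,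
    [/\ C (q k + r *: w k), C (q k - r *: w k), eps <= `|'d h (y k) (w k)| & 0 < r] &
    ~ C ('d h (h (y k)) ('d h (y k) (q k)) - k.+1%:R^-1 *: v)].
  by have := zP k; rewrite /y /q /w; case: (z k) => [[? ?] ?].
have [U [UU sU]] := ultraFilterLemma eventually_filter.
have [|y0 Ky0 yc] := @compact_ultra_cvg _ _ K U (fun k => (y k)) UU Kc.
  by apply: nearW => k; have [] := zP k.
have /cvg_ex[q0 qc] : cvg ('d h (y k) (q k) @[k --> U]).
  by apply: (diff_compact_cvg _ hc hC1 yc (rho := rho)) => k; have [] := zP k.
have /cvg_ex[w0 wc] : cvg ('d h (y k) (w k) @[k --> U]).
  by apply: (diff_compact_cvg _ hc hC1 yc (rho := 1)) => k; have [] := zP k.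
have r0 : 0 < r by have [_ _ _ []] := zP 0%N.
have Cd x u : C u -> C ('d h x u) by exact: strongly_positive_cone.
have Cp : C (q0 + r *: w0).
  have rwc : r *: 'd h (y k) (w k) @[k --> U] --> r *: w0 by exact: cvgZl_tmp.
  apply: (@closed_cvg _ _ U _ (fun k => 'd h (y k) (q k) + r *: 'd h (y k) (w k))
    C cC _ _ (cvgD qc rwc)); apply: nearW => k.
  have [_ _ _ [/(Cd (y k)) + _ _ _] _] := zP k.
  by rewrite linearD; congr (C (_ + _)); exact: linearZ.
have Cm : C (q0 - r *: w0).
  have rwc : r *: 'd h (y k) (w k) @[k --> U] --> r *: w0 by exact: cvgZl_tmp.
  apply: (@closed_cvg _ _ U _ (fun k => 'd h (y k) (q k) - r *: 'd h (y k) (w k))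
    C cC _ _ (cvgB qc rwc)); apply: nearW => k.
  have [_ _ _ [_ /(Cd (y k)) + _ _] _] := zP k.
  by rewrite linearB; congr (C (_ - _)); exact: linearZ.
have w0eps : eps <= `|w0|.
  apply: (@closed_cvg _ _ U _ (fun k => `|'d h (y k) (w k)|) [set x : R | eps <= x]
    (@closed_ge _ eps) _ _ (cvg_norm wc)).
  by apply: nearW => k; have [_ _ _ []] := zP k.
have q0n : q0 != 0.
  apply/eqP => q0E; move: Cp Cm; rewrite q0E add0r sub0r => Cp Cm.
  have /eqP := coneN Cc Cp Cm; rewrite scaler_eq0 gt_eqF//= => /eqP w00.
  by move: w0eps; rewrite w00 normr0 leNgt eps0.
have Cq0 : C q0.
  have := coneZ Cc _ (coneD Cc Cp Cm) (l := 2^-1).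
  rewrite addrACA subrr addr0 -mulr2n -[q0 *+ 2]scaler_nat scalerA mulVf// scale1r.
  by apply.
have Iq0 : interior C ('d h (h y0) q0).
  by rewrite -['d h _ _]subr0; apply: hpos; split; rewrite subr0//; apply/eqP.
have hyc : h (y k) @[k --> U] --> h y0.
  by apply: (cvg_comp _ _ yc); exact: differentiable_continuous.
have ic : k.+1%:R^-1 *: v @[k --> U] --> (0 : X).
  rewrite -(scale0r v); apply: cvgZr_tmp.
  apply: (cvg_trans _ (@cvg_harmonic R)); exact: cvg_app.
have lim : 'd h (h (y k)) ('d h (y k) (q k)) - k.+1%:R^-1 *: v @[k --> U] -->
    'd h (h y0) q0.
  by rewrite -[X in _ --> X]subr0; apply: cvgB => //; exact: cvg_diff.
have : \forall k \near U, C ('d h (h (y k)) ('d h (y k) (q k)) - k.+1%:R^-1 *: v).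
  exact: lim _ Iq0.
move=> /filter_ex[k Ck].
by have [_ _ _ _] := zP k; exact.
Qed.

End Positivity.

(** * Growth along the cone *)

Section Lyapunov.
Context {R : realType} {X : normedModType R}.
Implicit Types (h : X -> X) (x : X).

(** Countably many bases tending to 1, so that positivity of the exponent becomes a countable union
    over [j]. *)
Definition growth_rate (j : nat) : R := 1 + j.+1%:R^-1.

Lemma growth_rate_gt1 j : 1 < growth_rate j.
Proof. by rewrite /growth_rate ltrDl invr_gt0. Qed.

Lemma opnorm_diff_iter h n x : C1_map h ->
  opnorm ('d (iter n h) x) \is a fin_num.
Proof.
by move=> hC1; apply: opnorm_fin_num; apply: diff_continuous; exact: differentiable_iter.
Qed.

Lemma lambda_max_gt0 h x : C1_map h -> (0 < lambda_max x h)%E <->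
  exists j N : nat, forall n, (N <= n)%N ->
    ((growth_rate j ^+ n)%:E < opnorm ('d (iter n h) x))%E.
Proof.
move=> hC1; rewrite /lambda_max limn_einf_lim.
set u := (fun n : nat => _); rewrite (cvg_lim _ (@cvg_einfs_sup _ u))//.
split=> [/ereal_sup_gt[_ [N _ <-]] N0|[j [N jN]]].
  have [j jP] : exists j : nat, (j.+1%:R^-1%:E < einfs u N)%E.
    move: N0; case: (einfs _ _) => [r||//]; last by exists 0%N; rewrite ltry.
    by rewrite lte_fin => /ltr_add_invr[j]; rewrite add0r => jr; exists j; rewrite lte_fin.
  (* The threshold is at least 1 so that one may divide by [n]. *)
  exists j, (maxn N 1) => n; rewrite geq_max => /andP[Nn n0].
  have : (j.+1%:R^-1%:E < lne (opnorm ('d (iter n h) x)) * n%:R^-1%:E)%E.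
    by apply: lt_le_trans jP _; apply: ereal_inf_lbound; exists n.
  have nn0 : 0 < n%:R :> R by rewrite ltr0n.
  rewrite -(fineK (opnorm_diff_iter n x hC1)); set a := fine _.
  (* For a vanishing norm [lne] is [-oo], contradicting the lower bound. *)
  have [a0|a0] := leP a 0.
    by rewrite le0_lneNy ?lee_fin// mulNyr gtr0_sg ?invr_gt0// mul1e.
  rewrite lne_EFin// -EFinM !lte_fin ltr_pdivlMr// -ltr_expR lnK ?posrE//.
  apply: le_lt_trans; rewrite expRM_natr; apply: lerXn2r; rewrite ?nnegrE ?expR_ge0//.
    by rewrite ltW// (lt_trans ltr01)// growth_rate_gt1.
  exact: expR_ge1Dx.
apply: (@lt_le_trans _ _ (ln (growth_rate j))%:E).
  by rewrite lte_fin ln_gt0// growth_rate_gt1.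
apply: ereal_sup_ge; exists (einfs u (maxn N 1)); first by exists (maxn N 1).
apply: le_ereal_inf_tmp => _ [n /= + <-]; rewrite geq_max => /andP[Nn n0].
have nn0 : 0 < n%:R :> R by rewrite ltr0n.
have := jN n Nn; rewrite -(fineK (opnorm_diff_iter n x hC1)); set a := fine _.
rewrite lte_fin => an.
have b0 : 0 < growth_rate j by rewrite (lt_trans ltr01)// growth_rate_gt1.
have a0 : 0 < a by apply: lt_trans an; exact: exprn_gt0.
rewrite /u -(fineK (opnorm_diff_iter n x hC1)) -/a lne_EFin// -EFinM lee_fin.
rewrite ler_pdivlMr// mulr_natr -lnXn// ler_ln ?posrE ?exprn_gt0//.
exact: ltW.
Qed.

Lemma exprn_unbounded (b M : R) : 1 < b -> exists n, M < b ^+ n.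
Proof.
move=> b1; have b0 : 0 < b - 1 by rewrite subr_gt0.
have Bern n : 1 + n%:R * (b - 1) <= b ^+ n.
  elim: n => [|n IH]; first by rewrite mul0r addr0 expr0.
  rewrite exprS -natr1; have := ler_wpM2l (ltW (lt_trans ltr01 b1)) IH.
  apply: le_trans; have : 0 <= n%:R * (b - 1) ^+ 2 by rewrite mulr_ge0// sqr_ge0.
  by move=> ?; lra.
exists (Num.truncn (`|M| / (b - 1))).+1.
have := truncnS_gt (`|M| / (b - 1)); rewrite ltr_pdivrMr// => HM.
apply: lt_le_trans (Bern _); have := ler_norm M; lra.
Qed.

(** Otherwise the norms would decrease from [maxn N m] on, hence stay bounded, while they dominate
    an unbounded geometric sequence. *)
Lemma growth_steps h x j N m : C1_map h ->
  (forall n, (N <= n)%N ->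
    ((growth_rate j ^+ n)%:E < opnorm ('d (iter n h) x))%E) ->
  exists2 n, (m <= n)%N &
    growth_rate j ^+ n < fine (opnorm ('d (iter n h) x)) <=
    fine (opnorm ('d (iter n.+1 h) x)).
Proof.
move=> hC1 jN; apply: contrapT => H.
pose a n := fine (opnorm ('d (iter n h) x)).
have ja n : (N <= n)%N -> growth_rate j ^+ n < a n.
  by move=> /jN; rewrite -(fineK (opnorm_diff_iter n x hC1)) lte_fin.
pose p := maxn N m.
have ap k : a (p + k)%N <= a p.
  elim: k => [|k IH]; first by rewrite addn0.
  rewrite addnS; apply: le_trans IH; rewrite leNgt; apply/negP => lt_a; apply: H.
  exists (p + k)%N; first by rewrite (leq_trans (leq_maxr N m))// leq_addr.
  rewrite ja ?ltW//.
  by rewrite (leq_trans (leq_maxl N m))// leq_addr.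
have [n] := exprn_unbounded (a p) (growth_rate_gt1 j).
rewrite ltNge => /negP; apply; apply/ltW; apply: lt_le_trans (ap n).
apply: le_lt_trans (ja _ _); last by rewrite (leq_trans (leq_maxl N m))// leq_addr.
by rewrite ler_eXn2l ?growth_rate_gt1// leq_addl.
Qed.

End Lyapunov.

Section Growth.
Context {R : realType} {X : completeNormedModType R}.
Implicit Types (C K : set X) (h : X -> X) (x y v w e q : X).

Lemma diff_iter_cone C h n x v : is_cone C -> C1_map h ->
  (forall x, strongly_positive C ('d h x)) -> C v -> C ('d (iter n h) x v).
Proof.
move=> Cc hC1 hpos Cv; elim: n => [|n IH]; last first.
  by rewrite diff_iterS//; exact: strongly_positive_cone.
by rewrite (_ : iter 0 h = id)//; have [_ ->] := is_diff_id x.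
Qed.

(** Divide by [a n]: [q] is the image of [v], of norm at most [|v|], and [w] that of a vector [w0]
    realising at least half of the norm at time [n + 1]. Since [v] plus or minus [r *: w0] lies in
    [C], so does [q] plus or minus [r *: w]; and [a n <= a n.+1] gives [w] an image of norm at least
    1/2. Uniform positivity uses two more derivatives, hence [n.+2]. *)
Lemma growth_along_cone C h K v : is_cone C -> interior C v ->
  compact_map h -> C1_map h -> (forall x, strongly_positive C ('d h x)) ->
  compact K ->
  exists2 c : R, 0 < c & forall x n, K (iter n h x) ->
    let a n := fine (opnorm ('d (iter n h) x)) in
    0 < a n <= a n.+1 -> C ('d (iter n.+2 h) x v - (c * a n) *: v).
Proof.
move=> Cc vC hc hC1 hpos Kc; have [r r0 rC] := interior_coneP vC.
have [c c0 cP] := @uniform_positivity _ _ C h K v r `|v| 2^-1 Cc vC hc hC1 hpos Kc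
  ltac:(by rewrite invr_gt0).
exists c => // x n Kn an.
have aE : opnorm ('d (iter n h) x) = (an n)%:E by rewrite fineK// opnorm_diff_iter.
have bE : opnorm ('d (iter n.+1 h) x) = (an n.+1)%:E by rewrite fineK// opnorm_diff_iter.
move: aE bE; move: (an n) (an n.+1) => {an} a b aE bE /andP[a0 ab].
have [w0 w01 w0P] : exists2 w, `|w| <= 1 & b / 2 < `|'d (iter n.+1 h) x w|.
  apply: lt_opnorm; rewrite bE lte_fin ltr_pdivrMr// ltr_pMr ?ltr1n//.
  exact: lt_le_trans ab.
have Jle u : `|'d (iter n h) x u| <= a * `|u|.
  by apply: le_opnorm => [k y|]; [exact: linearZ|rewrite aE].
pose q := a^-1 *: 'd (iter n h) x v; pose w := a^-1 *: 'd (iter n h) x w0.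
have Jpm u : `|u| <= r -> C (a^-1 *: 'd (iter n h) x (v + u)).
  move=> ur; apply: coneZ => //; first by rewrite invr_gt0.
  by apply: diff_iter_cone => //; exact: rC.
have rw : `|r *: w0| <= r by rewrite normrZ gtr0_norm// ger_pMr.
have dZ y u : 'd h y (a^-1 *: u) = a^-1 *: 'd h y u by exact: linearZ.
have E1 u : 'd h (iter n h x) ('d (iter n h) x u) = 'd (iter n.+1 h) x u.
  by rewrite diff_iterS.
have E2 u : 'd h (h (iter n h x)) ('d (iter n.+1 h) x u) = 'd (iter n.+2 h) x u.
  by rewrite (diff_iterS n.+1).
have := cP (iter n h x) q w Kn.
rewrite /q /w !dZ !E1 E2 !normrZ gtr0_norm ?invr_gt0//.
have JZ u : 'd (iter n h) x (r *: u) = r *: 'd (iter n h) x u by exact: linearZ.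
move=> /(_ _ _ _ _ _ r0) H.
have {}H : C (a^-1 *: 'd (iter n.+2 h) x v - c *: v).
  apply: H.
  - by rewrite mulrC ler_pdivrMr// mulrC.
  - by rewrite mulrC ler_pdivrMr// mul1r (le_trans (Jle _))// ger_pMr.
  - by have := Jpm _ rw; rewrite linearD JZ scalerDr !scalerA [r * _]mulrC.
  - have := Jpm (- (r *: w0)); rewrite normrN => /(_ rw).
    by rewrite linearB JZ scalerBr !scalerA [r * _]mulrC.
  - rewrite mulrC ler_pdivlMr//; apply/ltW/(le_lt_trans _ w0P).
    by rewrite mulrC ler_pM2r// invr_gt0.
have := coneZ Cc a0 H.
by rewrite scalerBr !scalerA divff ?gt_eqF// scale1r mulrC.
Qed.

End Growth.

(** * Outer Lebesgue measure *)

Section OuterMeasure.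
Context {R : realType} {d : nat}.
Implicit Types (a b : 'rV[R]_d) (A E : set 'rV[R]_d).

Lemma box_volume_ge0 a b : (forall i, a ord0 i <= b ord0 i) -> 0 <= box_volume a b.
Proof. by move=> ab; apply: prodr_ge0 => i _; rewrite subr_ge0. Qed.

Lemma lebesgue_outer_ge0 E : (0 <= lebesgue_outer E)%E.
Proof.
apply: le_ereal_inf_tmp => _ [I [a [b [ab _ ->]]]].
by apply: esum_ge0 => k _; rewrite lee_fin box_volume_ge0.
Qed.

Lemma le_lebesgue_outer A E : A `<=` E -> (lebesgue_outer A <= lebesgue_outer E)%E.
Proof.
move=> AE; apply: ereal_inf_le_tmp => _ [I [a [b [ab cover ->]]]].
by exists I, a, b; split=> //; exact: subset_trans cover.
Qed.

(** Any countable index type is encoded in [nat] by [pickle]. The default corner [0] only keeps the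
    boxes well formed; its indices are not summed. *)
Lemma lebesgue_outer_cover (T : countType) (I : set T) (lo hi : T -> 'rV[R]_d) E :
  (forall k i, lo k ord0 i <= hi k ord0 i) ->
  E `<=` \bigcup_(k in I) box (lo k) (hi k) ->
  (lebesgue_outer E <= \esum_(k in I) (box_volume (lo k) (hi k))%:E)%E.
Proof.
move=> lohi EI; pose a n := if unpickle n is Some t then lo t else 0.
pose b n := if unpickle n is Some t then hi t else 0.
have ab n i : a n ord0 i <= b n ord0 i by rewrite /a /b; case: (unpickle n).
apply: ereal_inf_lbound; exists (pickle @` I), a, b; split=> //.
  move=> x /EI[k Ik kx]; exists (pickle k); first by exists k.
  by rewrite /a /b pickleK.
rewrite (reindex_esum I (pickle @` I) pickle).
- by apply: eq_esum => k _; rewrite /a /b pickleK.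
- by split=> [k Ik|k l _ _ /(pcan_inj pickleK)|//]; first exists k.
Qed.

(** The strict bounds yield actual covers, which are merged into one cover indexed by pairs. *)
Lemma lebesgue_outer_bigcup (A : nat -> set 'rV[R]_d) (c : nat -> R) (B : R) :
  (forall n, (lebesgue_outer (A n) < (c n)%:E)%E) ->
  (forall N, \sum_(n < N) c n <= B) ->
  (lebesgue_outer (\bigcup_n A n) <= B%:E)%E.
Proof.
move=> Ac cB.
have H n : exists z : set nat * (nat -> 'rV[R]_d) * (nat -> 'rV[R]_d),
    let: (J, a, b) := z in
    [/\ (forall k i, a k ord0 i <= b k ord0 i),
        A n `<=` \bigcup_(k in J) box (a k) (b k) &
        (\esum_(k in J) (box_volume (a k) (b k))%:E <= (c n)%:E)%E].
  have /ereal_inf_lt[_ [J [a [b [ab cover ->]]]] lt_c] := Ac n.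
  by exists (J, a, b); split=> //; exact: ltW.
have {H} [z zP] := choice H.
pose J n := (z n).1.1; pose a n := (z n).1.2; pose b n := (z n).2.
have {}zP n : [/\ (forall k i, a n k ord0 i <= b n k ord0 i),
    A n `<=` \bigcup_(k in J n) box (a n k) (b n k) &
    (\esum_(k in J n) (box_volume (a n k) (b n k))%:E <= (c n)%:E)%E].
  by have := zP n; rewrite /J /a /b; case: (z n) => [[? ?] ?].
have c0 n : 0 <= c n.
  by rewrite -lee_fin ltW//; apply: le_lt_trans (Ac n); exact: lebesgue_outer_ge0.
apply: (@le_trans _ _ (\esum_(k in setT `*`` J)
    (box_volume (a k.1 k.2) (b k.1 k.2))%:E)).
  apply: (lebesgue_outer_cover (lo := fun k => a k.1 k.2) (hi := fun k => b k.1 k.2)).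
    by move=> k i; have [] := zP k.1.
  move=> x [n _ Anx]; have [_ /(_ x Anx)[k Ik kx] _] := zP n.
  by exists (n, k).
rewrite -(@esum_esum _ _ _ setT J (fun n k => (box_volume (a n k) (b n k))%:E)); last first.
  by move=> n k; rewrite lee_fin box_volume_ge0//; have [] := zP n.
apply: (@le_trans _ _ (\esum_(n in setT) (c n)%:E)).
  by apply: le_esum => n _; have [] := zP n.
rewrite -nneseries_esumT; last by move=> n; rewrite lee_fin.
apply: lime_le; first by apply: is_cvg_nneseries => n _ _; rewrite lee_fin.
by apply: nearW => N; rewrite sumEFin lee_fin big_mkord.
Qed.

Lemma lebesgue_outer_geometric (A : nat -> set 'rV[R]_d) (M r : R) :
  0 < r < 1 -> (forall n, (lebesgue_outer (A n) < (M * r ^+ n)%:E)%E) ->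
  (lebesgue_outer (\bigcup_n A n) <= (M / (1 - r))%:E)%E.
Proof.
move=> /andP[r0 r1] AM; apply: (lebesgue_outer_bigcup AM) => N.
have M0 : 0 <= M.
  rewrite -lee_fin ltW//; have := AM 0%N; rewrite expr0 mulr1.
  by apply: le_lt_trans; exact: lebesgue_outer_ge0.
have := @geometric_le_lim R N M r M0 r0.
by rewrite gtr0_norm// /series /= big_mkord; apply.
Qed.

Lemma lebesgue_outer_bigcup0 (A : nat -> set 'rV[R]_d) :
  (forall n, lebesgue_outer (A n) = 0%E) -> lebesgue_outer (\bigcup_n A n) = 0%E.
Proof.
move=> A0; apply/eqP; rewrite eq_le lebesgue_outer_ge0 andbT.
apply/lee_addgt0Pr => e e0; rewrite add0e.
have h1 : 0 < (2^-1 : R) < 1 by rewrite invr_gt0 invf_lt1// ltr0n ltr1n.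
(* The weights [e / 2 ^ (n + 1)] sum to [e]. *)
have := @lebesgue_outer_geometric A (e / 2) 2^-1 h1.
rewrite (_ : e / 2 / _ = e); last by field.
apply => n; rewrite A0 lte_fin mulr_gt0 ?exprn_gt0// divr_gt0//.
Qed.

End OuterMeasure.

(** * Counting on grids *)

Lemma card_ffun_coord (d m : nat) (i : 'I_d) (A : pred 'I_m) :
  #|[pred k : {ffun 'I_d -> 'I_m} | A (k i)]| = (#|A| * m ^ d.-1)%N.
Proof.
rewrite -sum1_card big_mkcond /=.
(* The indicator becomes a product over coordinates, trivial off [i], so that the count factors. *)
pose F (i' : 'I_d) (j : 'I_m) : nat := if i' == i then nat_of_bool (A j) else 1%N.
under eq_bigr => k _.
  rewrite inE (_ : (if _ then _ else _) = \prod_i' F i' (k i'))%N; last first.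
    rewrite (bigD1 i)//= big1 ?muln1 => [|i' /negbTE ii']; last by rewrite /F ii'.
    by rewrite /F eqxx; case: (A (k i)).
  over.
rewrite -(bigA_distr_bigA F) (bigD1 i)//=; congr (_ * _)%N.
  rewrite -sum1_card [RHS]big_mkcond; apply: eq_bigr => j _.
  by rewrite /F eqxx -[j \in A]/(A j); case: (A j).
rewrite (eq_bigr (fun=> m)) => [|i' /negbTE ii']; last first.
  by rewrite (eq_bigr (fun=> 1%N)) ?sum1_card ?card_ord// => j _; rewrite /F ii'.
by rewrite prod_nat_const cardC1 card_ord.
Qed.

(** The map sending [j] to [j + s - m] injects these indices into the integers below [s]. *)
Lemma card_ord_overflow (m s : nat) : (#|[pred j : 'I_m | m <= j + s]| <= s)%N.
Proof.
rewrite cardE -(size_map (fun j : 'I_m => (j + s - m)%N)) -[leqRHS](size_iota 0).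
apply: uniq_leq_size.
  rewrite map_inj_in_uniq ?enum_uniq// => j k; rewrite !mem_enum !inE => jm km jk.
  by apply: val_inj => /=; lia.
move=> n /mapP[j]; rewrite mem_enum inE mem_iota => jm ->.
by have := ltn_ord j; lia.
Qed.

Section TorusShift.
Context {R : realType} {d m : nat}.
Implicit Types (G : ('I_d -> nat) -> R) (s : 'I_d -> nat).
Let K := {ffun 'I_d -> 'I_m.+1}.

(* Shifting modulo [m.+1] permutes the grid; only the points that leave the
   grid see the difference with the plain shift. *)
Lemma sum_grid_shift G s (M : R) :
  (forall k : K, `|G (fun i => k i)| <= M) ->
  (forall k : K, `|G (fun i => (k i + s i)%N)| <= M) ->
  `|\sum_(k : K) G (fun i => (k i + s i)%N) - \sum_(k : K) G (fun i => k i)| <=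
    2 * M * ((\sum_i s i) * m.+1 ^ d.-1)%N%:R.
Proof.
move=> GM GsM; pose S : K := [ffun i => inZp (s i)].
have M0 : 0 <= M by apply: le_trans (GM [ffun=> ord0]).
rewrite [X in _ - X](reindex (fun k : K => k + S)) /=; last first.
  by exists (fun k : K => k - S) => k _; [exact: addrK|exact: subrK].
rewrite -sumrB; apply: le_trans (ler_norm_sum _ _ _) _.
pose bad (k : K) := [exists i, m < k i + s i]%N.
have H (k : K) : `|G (fun i => (k i + s i)%N) - G (fun i => (k + S) i)| <=
    if bad k then 2 * M else 0.
  case: ifPn => [_|/existsPn nbad].
    apply: le_trans (ler_normB _ _) _; have := GM (k + S); have := GsM k; lra.
  rewrite (_ : (fun i => nat_of_ord ((k + S) i)) = (fun i => (k i + s i)%N)) ?subrr ?normr0//.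
  apply/funext => i; have := nbad i; rewrite -leqNgt => ksm.
  by rewrite !ffunE /= modnDmr modn_small.
apply: le_trans (ler_sum _ (fun k _ => H k)) _.
rewrite -big_mkcond /= sumr_const -[leLHS]mulr_natr ler_wpM2l ?mulr_ge0// ler_nat.
apply: (@leq_trans (\sum_i #|[pred k : K | m < k i + s i]|)%N).
  rewrite -sum1_card big_mkcond /=.
  apply: (@leq_trans (\sum_(k : K) \sum_i (m < k i + s i))%N).
    apply: leq_sum => k _; case: ifPn => // /existsP[i mi].
    by rewrite (bigD1 i)//= mi.
  rewrite exchange_big /=; apply: leq_sum => i _.
  by rewrite -sum1_card [leqRHS]big_mkcond; apply: leq_sum => k _; rewrite inE; case: ifP.
rewrite big_distrl /=; apply: leq_sum => i _.
rewrite (card_ffun_coord i [pred j : 'I_m.+1 | m < j + s i])%N leq_mul2r.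
by rewrite card_ord_overflow orbT.
Qed.

End TorusShift.

Section Grid.
Context {R : realType} {d : nat}.
Implicit Types (u p : 'rV[R]_d) (W : set 'rV[R]_d).

Definition cube (L : R) : set 'rV[R]_d := [set u | forall i, `|u ord0 i| <= L].

Lemma lebesgue_outer_fin_cover (T : finType) (H : {set T}) (lo hi : T -> 'rV[R]_d)
    (V : R) (E : set 'rV[R]_d) :
  (forall k i, lo k ord0 i <= hi k ord0 i) ->
  (forall k, box_volume (lo k) (hi k) = V) ->
  (forall u, E u -> exists2 k, k \in H & box (lo k) (hi k) u) ->
  (lebesgue_outer E <= (#|H|%:R * V)%:E)%E.
Proof.
move=> lohi volV EH.
have EH' : E `<=` \bigcup_(k in [set` enum H]) box (lo k) (hi k).
  by move=> u /EH[k kH ku]; exists k; rewrite //= mem_enum.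
apply: le_trans (lebesgue_outer_cover lohi EH') _.
rewrite esum_fset => [|//|k _]; last by rewrite lee_fin box_volume_ge0.
rewrite -fsbig_seq ?enum_uniq// big_enum /=.
under eq_bigr do rewrite volV.
by rewrite sumEFin lee_fin sumr_const mulr_natl.
Qed.

(* Summing [f (u + delta p) - f u] over a grid of mesh [delta] leaves only
   boundary terms, in number proportional to [delta ^ (1 - d)]; every cell of
   the grid that meets [W] contributes at least [delta * kappa]. *)
Lemma lebesgue_outer_steep (f : 'rV[R]_d -> R) (a : 'I_d -> nat) (T : nat)
    (L M kappa del0 : R) W (p := \row_i ((a i)%:R - T%:R)) :
  (0 < d)%N -> 0 < L -> 0 < kappa -> 0 < del0 ->
  (forall u, cube (L + 1) u -> `|f u| <= M) ->
  (forall u del, 0 <= del -> f u <= f (u + del *: p)) ->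
  (forall del u u', 0 < del <= del0 -> W u -> cube L u ->
    (forall i, `|u ord0 i - u' ord0 i| <= del) ->
    f u' + del * kappa <= f (u' + del *: p)) ->
  (lebesgue_outer (W `&` cube L) <=
    (2 * M * (\sum_i (a i + T))%N%:R * (2 * L) ^+ d.-1 / kappa)%:E)%E.
Proof.
move=> d0 L0 kappa0 del00 fM fmono fsteep.
set S := (\sum_i (a i + T))%N.
have aS i : (a i + T <= S)%N by rewrite /S (bigD1 i)//= leq_addr.
(* The first summand ensures [del <= del0]; the second ensures [del * S <= 1], which keeps shifted
   grid points in [cube (L + 1)]. *)
pose m := Num.truncn (2 * L / del0 + 2 * L * S%:R); pose del := 2 * L / m.+1%:R.
have m0 : 0 < m.+1%:R :> R by [].
have L20 : 0 < 2 * L by rewrite mulr_gt0.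
have mP : 2 * L / del0 + 2 * L * S%:R < m.+1%:R by exact: truncnS_gt.
have Ldel : 0 < 2 * L / del0 by exact: divr_gt0.
have LS : 0 <= 2 * L * S%:R by rewrite mulr_ge0// ltW.
have del_gt0 : 0 < del by exact: divr_gt0.
have mdel : m.+1%:R * del = 2 * L by rewrite /del mulrC divfK ?gt_eqF.
have del_le : del <= del0.
  rewrite /del ler_pdivrMr// -ler_pdivrMl//; lra.
have delS : del * S%:R <= 1.
  rewrite /del mulrAC ler_pdivrMr// mul1r; lra.
(* The offset by [T] makes [P (k + T)] the lower corner of cell [k]; moving by [del *: p] then
   changes the shift [T] into the shift [a], both natural even if [p] has negative components. *)
pose P (j : 'I_d -> nat) : 'rV[R]_d := \row_i (- L + del * ((j i)%:R - T%:R)).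
pose K := {ffun 'I_d -> 'I_m.+1}.
pose G j := f (P j).
have Pcube (k : K) (s : 'I_d -> nat) : (forall i, s i <= S)%N ->
    cube (L + 1) (P (fun i => (k i + s i)%N)).
  move=> sS i; rewrite mxE natrD ler_norml.
  have km : del * (k i)%:R <= 2 * L.
    by rewrite -mdel mulrC ler_pM2r// ler_nat ltnW.
  have sl : del * (s i)%:R <= 1.
    by apply: le_trans delS; rewrite ler_pM2l// ler_nat.
  have Tl : del * T%:R <= 1.
    by apply: le_trans delS; rewrite ler_pM2l// ler_nat (leq_trans (leq_addl (a i) _)).
  have k0 : 0 <= del * (k i)%:R by rewrite mulr_ge0// ltW.
  have s0 : 0 <= del * (s i)%:R by rewrite mulr_ge0// ltW.
  have T0 : 0 <= del * T%:R by rewrite mulr_ge0// ltW.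
  by apply/andP; split; lra.
have GM (k : K) s : (forall i, s i <= S)%N -> `|G (fun i => (k i + s i)%N)| <= M.
  by move=> sS; apply: fM; exact: Pcube.
have GM0 (k : K) : `|G (fun i => k i)| <= M.
  have := GM k (fun=> 0%N) (fun=> isT).
  by congr (`|G _| <= M); apply/funext => i; rewrite addn0.
have step (k : K) : P (fun i => (k i + T)%N) + del *: p = P (fun i => (k i + a i)%N).
  by apply/rowP => i; rewrite !mxE !natrD; ring.
pose lo (k : K) := P (fun i => (k i + T)%N).
pose hi (k : K) : 'rV[R]_d := \row_i (lo k ord0 i + del).
pose H : {set K} :=
  finset (fun k : K => `[< exists u, [/\ W u, cube L u & box (lo k) (hi k) u] >]).
have cell u : cube L u -> exists k : K, box (lo k) (hi k) u.
  move=> uL; suff /choice[g gP] : forall i, exists j : 'I_m.+1,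
      - L + del * j%:R <= u ord0 i <= - L + del * j%:R + del.
    exists (finfun g) => i; have := gP i.
    by rewrite !mxE ffunE natrD addrK.
  move=> i; have := uL i; rewrite ler_norml => /andP[uL1 uL2].
  pose t := (u ord0 i + L) / del.
  have t0 : 0 <= t by rewrite divr_ge0 ?(ltW del_gt0)//; lra.
  have tE : u ord0 i = - L + del * t.
    by rewrite /t mulrC divfK ?gt_eqF//; ring.
  have tm : t <= m.+1%:R.
    by rewrite /t ler_pdivrMr// mdel; lra.
  have /andP[n1 n2] := truncn_itv t0.
  (* The minimum puts the endpoint [L], where [t = m + 1], into the last cell. *)
  exists (inord (minn m (Num.truncn t))); rewrite inordK ?ltnS ?geq_minl//.
  rewrite tE -addrA !lerD2l -[X in _ + X]mulr1 -mulrDr !ler_pM2l// natr1.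
  rewrite /minn; case: ltnP => [mt|tm']; last by rewrite n1 ltW.
  by rewrite tm andbT (le_trans _ n1)// ler_nat ltnW.
have card_le : #|H|%:R * (del * kappa) <= 2 * M * (S * m.+1 ^ d.-1)%N%:R.
  pose D (k : K) := G (fun i => (k i + a i)%N) - G (fun i => (k i + T)%N).
  have D0 k : 0 <= D k.
    by rewrite subr_ge0 /G -step; apply: fmono; exact: ltW.
  have DH k : k \in H -> del * kappa <= D k.
    rewrite inE => /asboolP[u [Wu uL uk]].
    rewrite lerBrDl /G -step; apply: (fsteep del u) => //.
      by rewrite del_gt0 del_le.
    move=> i; rewrite -/(lo k) ler_norml; have /andP[] := uk i.
    by rewrite [hi k _ _]mxE => *; apply/andP; split; lra.
  apply: (@le_trans _ _ (\sum_(k : K) D k)).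
    rewrite mulr_natl -sumr_const [leRHS](bigID (mem H)) /=.
    by rewrite ler_wpDr ?sumr_ge0//; exact: ler_sum.
  (* Both shifted sums are compared with the unshifted one; the two boundary terms add up to [S]. *)
  have Ha := @sum_grid_shift R d m G a M GM0 (fun k => GM k a
    (fun i => leq_trans (leq_addr T (a i)) (aS i))).
  have HT := @sum_grid_shift R d m G (fun=> T) M GM0 (fun k => GM k (fun=> T)
    (fun i => leq_trans (leq_addl (a i) T) (aS i))).
  rewrite /D sumrB; move: Ha HT.
  set X := \sum_(k : K) G (fun i => (k i + a i)%N).
  set Y := \sum_(k : K) G (fun i => (k i + T)%N).
  set Z := \sum_(k : K) G (fun i => k i).
  rewrite /S big_split /= mulnDl natrD mulrDr !ler_norml => /andP[_ HX] /andP[HY _].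
  lra.
have lohi k i : lo k ord0 i <= hi k ord0 i.
  by rewrite [hi k _ _]mxE lerDl ltW.
have vol k : box_volume (lo k) (hi k) = del ^+ d.
  rewrite /box_volume -[in RHS](card_ord d) -prodr_const; apply: eq_bigr => i _.
  by rewrite [hi k _ _]mxE addrC addKr.
have cover u : (W `&` cube L) u -> exists2 k, k \in H & box (lo k) (hi k) u.
  move=> [Wu uL]; have [k uk] := cell u uL; exists k => //.
  by rewrite inE; apply/asboolP; exists u.
apply: (le_trans (lebesgue_outer_fin_cover lohi vol cover)).
rewrite lee_fin ler_pdivlMr//.
(* One factor [del] goes into [card_le]; the other [d - 1] cancel [m.+1 ^ d.-1], so the mesh
   disappears from the bound. *)
have -> : #|H|%:R * del ^+ d * kappa = #|H|%:R * (del * kappa) * del ^+ d.-1.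
  have -> : del ^+ d = del * del ^+ d.-1 by rewrite -exprS prednK.
  by ring.
apply: le_trans (ler_wpM2r _ card_le) _; first by rewrite exprn_ge0// ltW.
rewrite -mdel [(_ * del) ^+ _]exprMn natrM natrX.
by rewrite le_eqVlt; apply/orP; left; apply/eqP; ring.
Qed.

End Grid.

(** * Affine charts and attractors *)

Section AffineChart.
Context {R : realType} {X : completeNormedModType R} {d : nat}.
Implicit Types (u p : 'rV[R]_d) (e : 'I_d -> X) (x : X).

Definition affine_chart x e u : X := x + \sum_i u ord0 i *: e i.

Lemma affine_chartD x e u p (s : R) :
  affine_chart x e (u + s *: p) = affine_chart x e u + s *: \sum_i p ord0 i *: e i.
Proof.
rewrite /affine_chart -addrA; congr (_ + _).
rewrite scaler_sumr -big_split /=; apply: eq_bigr => i _.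
by rewrite !mxE scalerDl scalerA.
Qed.

Lemma affine_chart_bounded x e (L : R) : bounded_set (affine_chart x e @` cube L).
Proof.
exists (`|x| + \sum_i L * `|e i|); split; first exact: num_real.
move=> M HM _ [u uL <-]; apply: le_trans (ltW HM).
apply: le_trans (ler_normD _ _) _; rewrite lerD2l.
apply: le_trans (ler_norm_sum _ _ _) _; apply: ler_sum => i _.
by rewrite normrZ ler_wpM2r.
Qed.

(** By contradiction along an ultrafilter: the coordinates lie in [[- L, L]], and the two points of
    each pair have the same limit. *)
Lemma affine_chart_unif_continuous (H : X -> X) x e (L eta : R) :
  continuous H -> 0 < eta -> exists2 del : R, 0 < del &
    forall u u', cube L u -> cube L u' ->
      (forall i, `|u ord0 i - u' ord0 i| <= del) ->
      `|H (affine_chart x e u) - H (affine_chart x e u')| <= eta.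
Proof.
move=> Hc eta0; apply: contrapT => /forall2NP nH.
have {}nH k : exists z : 'rV[R]_d * 'rV[R]_d, [/\ cube L z.1, cube L z.2,
    forall i, `|z.1 ord0 i - z.2 ord0 i| <= k.+1%:R^-1 &
    eta < `|H (affine_chart x e z.1) - H (affine_chart x e z.2)|].
  have [|] := nH k.+1%:R^-1; first by [].
  move=> nHk; apply: contrapT => /forallNP Hz; apply: nHk => u u' uL u'L uu'.
  by rewrite leNgt; apply/negP => lt_eta; apply: (Hz (u, u')).
have {nH} [z zP] := choice nH.
have [U [UU sU]] := ultraFilterLemma eventually_filter.
have /choice[l lP] : forall i, exists l : R, (z k).1 ord0 i @[k --> U] --> l.
  move=> i.
  have [|l _ lP] := @compact_ultra_cvg _ _ _ U (fun k => (z k).1 ord0 i) UU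
    (@segment_compact R (- L) L); last by exists l.
  by apply: nearW => k; rewrite /= in_itv /= -ler_norml; have [] := zP k.
have lP' i : (z k).2 ord0 i @[k --> U] --> l i.
  have -> : (fun k => (z k).2 ord0 i) =
      (fun k => (z k).1 ord0 i - ((z k).1 ord0 i - (z k).2 ord0 i)).
    by apply/funext => k; rewrite opprB addrC subrK.
  rewrite -[X in _ --> X]subr0; apply: cvgB => //.
  apply/cvgr0Pnorm_le => eps eps0.
  have : \forall k \near U, k.+1%:R^-1 <= eps.
    apply: sU; have /cvgr0Pnorm_le/(_ eps eps0) := @cvg_harmonic R.
    by apply: filterS => k /=; apply: le_trans; exact: ler_norm.
  by apply: filterS => k; apply: le_trans; have [_ _] := zP k.
pose y0 := x + \sum_i l i *: e i.
have yc (w : nat -> 'rV[R]_d) : (forall i, w k ord0 i @[k --> U] --> l i) ->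
    H (affine_chart x e (w k)) @[k --> U] --> H y0.
  move=> wl; apply: (@cvg_comp _ _ _ (fun k => affine_chart x e (w k)) H U (nbhs y0) _ _ (Hc y0)).
  apply: cvgD; first exact: cvg_cst.
  elim: (index_enum _) => [|i r IH].
    by rewrite big_nil; under eq_cvg do rewrite big_nil; exact: cvg_cst.
  rewrite big_cons; under eq_cvg do rewrite big_cons.
  by apply: cvgD => //; apply: cvgZr_tmp; exact: wl.
have : (H (affine_chart x e (z k).1) - H (affine_chart x e (z k).2)) @[k --> U] --> 0.
  rewrite -(subrr (H y0)); apply: cvgB; exact: yc.
move=> /cvgr0Pnorm_le/(_ eta eta0)/filter_ex[k].
by rewrite leNgt; have [_ _ _ ->] := zP k.
Qed.

End AffineChart.

Section Attractor.
Context {R : realType} {X : completeNormedModType R}.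
Implicit Types (h : X -> X) (A D : set X).

(** [M + 2] is a bound [M + 1] on the compact set [A] plus the distance 1 within which the iterates
    of [D] eventually stay. *)
Lemma attractor_bound h A D : is_attractor h A -> bounded_set D ->
  exists M (n0 : nat), forall n x, (n0 <= n)%N -> D x -> `|iter n h x| <= M.
Proof.
move=> [cA _ _ attr] bD.
have [M [_ AM]] := compact_bounded cA.
have /fine_cvgP[fin /cvgrPdist_lt/(_ 1 ltr01)] := attr D bD.
move=> /(filterI fin)[n0 _ n0P].
exists (M + 2), n0 => n x n0n Dx; have [/= nfin] := n0P n n0n.
set s := maxe _ _ in nfin *; rewrite sub0r normrN => s1.
have : (set_dist (iter n h x) A < 1%:E)%E.
  apply: (@le_lt_trans _ _ s); last first.
    by rewrite -(fineK nfin) lte_fin; apply: le_lt_trans s1; exact: ler_norm.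
  by rewrite /s le_max; apply/orP; right; apply: ereal_sup_ubound; exists x.
move=> /ereal_inf_lt[_ [b Ab <-]]; rewrite lte_fin => xb.
have bM : `|b| <= M + 1 by apply: AM => //; rewrite ltrDl.
rewrite -[iter n h x](subrK b); apply: le_trans (ler_normD _ _) _; lra.
Qed.

End Attractor.

(** * Nullity in affine charts *)

Section NullSet.
Context {R : realType} {X : completeNormedModType R} {d : nat}.
Context (C A : set X) (F0 : X -> X) (Cc : is_cone C) (Fcompact : compact_map F0)
  (FC1 : C1_map F0) (Fpos : forall x : X, strongly_positive C ('d F0 x))
  (Aattr : is_attractor F0 A).
Context (x0 : X) (e : 'I_d -> X) (a : 'I_d -> nat) (T : nat).

Let p : 'rV[R]_d := \row_i ((a i)%:R - T%:R).
Let v : X := \sum_i p ord0 i *: e i.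
Let y := affine_chart x0 e.

Context (vC : interior C v) (v0 : v != 0).

Let steep n (kappa : R) : set 'rV[R]_d :=
  [set u | C ('d (iter n F0) (y u) v - kappa *: v)].

Lemma dim_gt0 : (0 < d)%N.
Proof.
rewrite lt0n; apply/eqP => d0; move/eqP: v0; apply; rewrite /v.
by apply: big1 => i _; have := ltn_ord i; rewrite [X in (_ < X)%N]d0 ltn0.
Qed.

Lemma affine_chart_dir u (s : R) : y (u + s *: p) = y u + s *: v.
Proof. exact: affine_chartD. Qed.

(** The grid count is applied to [Phi] along the chart, after [n] iterations: bounded thanks to the
    attractor, monotone along [p] because the derivatives preserve [C]. The mesh depends on [n] and
    [kappa], but [Q] does not. *)
Lemma lebesgue_outer_steep_iter (L : R) : 0 < L ->
  exists (Q : R) (n0 : nat), forall n (kappa : R), (n0 <= n)%N -> 0 < kappa ->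
    (lebesgue_outer (steep n kappa `&` cube L) <= (Q / kappa)%:E)%E.
Proof.
move=> L0; have [hd _] := FC1.
have [Phi [MP [MP0 PhiM PhiD]]] := cone_functional Cc vC v0.
have [M [n0 Mn0]] := attractor_bound Aattr (affine_chart_bounded x0 e (L + 1)).
pose S := (\sum_i (a i + T))%N.
pose Q := 2 * (2 * (MP * M) * S%:R * (2 * L) ^+ d.-1).
exists Q, n0 => n kappa n0n kappa0.
have [r r0 rC] := interior_coneP vC.
pose H x := 'd (iter n F0) x v.
have Hc : continuous H by exact: continuous_diff_iter.
have k20 : 0 < kappa / 2 by exact: divr_gt0.
(* Half of [kappa] is sacrificed: a variation of [H] of norm at most [r * (kappa / 2)] is absorbed
   by [(kappa / 2) *: v]. Hence the outer factor 2 in [Q]. *)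
have [del1 del10 del1P] := affine_chart_unif_continuous x0 e (L + 1) Hc
  (mulr_gt0 r0 k20).
have pS i : `|p ord0 i| <= S%:R.
  rewrite mxE; apply: le_trans (ler_normB _ _) _.
  by rewrite !normr_nat -natrD ler_nat /S (bigD1 i)//= leq_addr.
have S10 : 0 < 1 + S%:R :> R by rewrite ltr_pwDl.
(* A coordinate moves by at most [del] from [u] to [u'] and [del * S] along [p]; the bound 1 keeps
   the point in [cube (L + 1)]. *)
pose del0 := Num.min 1 del1 / (1 + S%:R).
have del00 : 0 < del0 by rewrite divr_gt0// lt_min ltr01 del10.
have -> : Q / kappa = 2 * (MP * M) * S%:R * (2 * L) ^+ d.-1 / (kappa / 2).
  by rewrite /Q; field; rewrite gt_eqF.
apply: (@lebesgue_outer_steep R d (fun u => Phi (iter n F0 (y u))) a T L (MP * M)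
  (kappa / 2) del0) => //.
- exact: dim_gt0.
- move=> u uL; apply: le_trans (PhiM _) _; rewrite ler_wpM2l//.
  by apply: Mn0 => //; exists u.
- move=> u del del0'; rewrite -/p affine_chart_dir -[leLHS]addr0; apply: PhiD.
  rewrite -(mulr0 del); apply: cone_mean_value => // [z|s _].
    exact: differentiable_iter.
  by rewrite scale0r subr0; apply: diff_iter_cone => //; exact: interior_subset.
- move=> del u u' /andP[del_gt0 del_le] Wu uL uu'.
  rewrite -/p affine_chart_dir; apply: PhiD.
  apply: cone_mean_value => // [z||s /andP[s0 sdel]]; [exact: differentiable_iter|exact: ltW|].
  rewrite -affine_chart_dir.
  have close i : `|u ord0 i - (u' + s *: p) ord0 i| <= Num.min 1 del1.
    apply: (@le_trans _ _ (del * (1 + S%:R))); last by rewrite -ler_pdivlMr.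
    rewrite !mxE opprD addrA; apply: le_trans (ler_normB _ _) _.
    rewrite [leRHS]mulrDr mulr1; apply: lerD; first exact: uu'.
    rewrite normrM ger0_norm//; apply: ler_pM => //.
    by have := pS i; rewrite mxE.
  have cubeu' : cube (L + 1) (u' + s *: p).
    move=> i; rewrite -[X in `|X|](subKr (u ord0 i)).
    apply: le_trans (ler_normB _ _) _; apply: lerD; first exact: uL.
    by apply: le_trans (close i) _; rewrite ge_min lexx.
  have cubeu : cube (L + 1) u.
    by move=> i; apply: le_trans (uL i) _; rewrite lerDl.
  have Hclose : `|H (y (u' + s *: p)) - H (y u)| <= r * (kappa / 2).
    rewrite distrC; apply: del1P => // i.
    by apply: le_trans (close i) _; rewrite ge_min lexx orbT.
  have := interior_cone_norm Cc r0 rC (H (y (u' + s *: p)) - H (y u)).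
  set w := _ - H (y u) => Cw.
  have Cw' : C ((kappa / 2) *: v + w).
    have := coneD Cc (coneZ_ge0 (l := kappa / 2 - `|w| / r) Cc _ (interior_subset vC)) Cw.
    rewrite addrA -scalerDl subrK; apply.
    by rewrite subr_ge0 ler_pdivrMr// mulrC.
  have := coneD Cc Wu Cw'; congr C.
  have -> : kappa *: v = (kappa / 2) *: v + (kappa / 2) *: v.
    by rewrite -scalerDl; congr (_ *: _); field.
  rewrite -/(H _) -/(H _) /w opprD !addrA subrK.
  by rewrite [LHS](ACl ((3*2)*(1*4)))%AC /= subrr addr0.
Qed.

Lemma lebesgue_outer_growth (L : R) (j : nat) : 0 < L ->
  lebesgue_outer [set u | cube L u /\ exists N : nat, forall n, (N <= n)%N ->
    ((growth_rate j ^+ n)%:E < opnorm ('d (iter n F0) (y u)))%E] = 0%E.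
Proof.
move=> L0; set E := [set u | _]; pose b : R := growth_rate j.
have b1 : 1 < b by exact: growth_rate_gt1.
have b0 : 0 < b by exact: lt_trans b1.
have [Q [n1 QP]] := lebesgue_outer_steep_iter L0.
have bD := affine_chart_bounded x0 e L.
have [M [n0 Mn0]] := attractor_bound Aattr bD.
have [_ Fbounded] := Fcompact.
(* The compact set is the closure of the image of a ball that contains the orbit from time [n0] on;
   one more step enters it, hence [n0 < n]. *)
have [c c0 cP] : exists2 c : R, 0 < c & forall u n, cube L u -> (n0 < n)%N ->
    let g n := fine (opnorm ('d (iter n F0) (y u))) in
    0 < g n <= g n.+1 -> C ('d (iter n.+2 F0) (y u) v - (c * g n) *: v).
  have bB : bounded_set [set x : X | `|x| <= M].
    by exists M; split; [exact: num_real|move=> k Mk x /= /le_trans; apply; exact: ltW].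
  have := Fbounded _ bB; rewrite precompactE => Kc.
  have [c c0 cP] := growth_along_cone Cc vC Fcompact FC1 Fpos Kc.
  exists c => // u [//|n] uL n0n; apply: cP; apply: subset_closure.
  by exists (iter n F0 (y u)) => //; apply: Mn0 => //; exists u.
pose W n := steep n.+2 (c * b ^+ n) `&` cube L.
(* Growth steps recur arbitrarily late, so the cover may start at any [N]. *)
have EW N : E `<=` \bigcup_n W (n + N)%N.
  move=> u [uL [N1 uN1]].
  have [n + /andP[bn gn]] := growth_steps (maxn N n0.+1) FC1 uN1.
  rewrite geq_max => /andP[Nn n0n].
  exists (n - N)%N => //; rewrite /W subnK//; split => //.
  have bn0 : 0 < b ^+ n by rewrite exprn_gt0.
  have := cP u n uL n0n; cbv zeta; rewrite (lt_trans bn0 bn) gn => /(_ isT).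
  rewrite /steep /mkset; move: (fine (opnorm ('d (iter n F0) (y u)))) bn {gn} => g bn.
  move: ('d (iter n.+2 F0) (y u) v) => J Cg.
  have gb : 0 < c * (g - b ^+ n) by rewrite mulr_gt0// subr_gt0.
  have := coneD Cc Cg (coneZ Cc gb (interior_subset vC)); congr C.
  rewrite -addrA; congr (J + _).
  rewrite -[- ((c * g) *: v)]scaleNr -scalerDl -[RHS]scaleNr.
  by congr (_ *: _); ring.
have Q1 : 0 < `|Q| + 1 by rewrite ltr_wpDl.
have WQ n : (n1 <= n)%N -> (lebesgue_outer (W n) < ((`|Q| + 1) / c / b ^+ n)%:E)%E.
  move=> n1n; have kap : 0 < c * b ^+ n by rewrite mulr_gt0// exprn_gt0.
  apply: le_lt_trans (QP n.+2 _ _ kap) _; first by rewrite (leq_trans n1n)// ltnW.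
  rewrite lte_fin -mulrA -invfM ltr_pM2r ?invr_gt0//.
  by apply: le_lt_trans (ler_norm Q) _; rewrite ltrDl.
apply/eqP; rewrite eq_le lebesgue_outer_ge0 andbT.
apply/lee_addgt0Pr => eps eps0; rewrite add0e.
have bi1 : b^-1 < 1 by rewrite invf_lt1.
have bi0 : 0 < b^-1 by rewrite invr_gt0.
(* Chosen so that [B < b ^+ N] makes the geometric tail from [N] at most [eps]. *)
pose B := (`|Q| + 1) / c / (1 - b^-1) / eps.
have [N0 BN0] := exprn_unbounded B b1.
pose N := maxn N0 n1.
have BN : B < b ^+ N.
  by apply: lt_le_trans BN0 _; rewrite ler_eXn2l// leq_maxl.
apply: (@le_trans _ _ (((`|Q| + 1) / c / b ^+ N) / (1 - b^-1))%:E).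
  apply: le_trans (le_lebesgue_outer (EW N)) _.
  apply: lebesgue_outer_geometric; first by rewrite bi0 bi1.
  move=> n; apply: lt_le_trans (WQ _ _) _; first by rewrite (leq_trans (leq_maxr N0 n1))// leq_addl.
  by rewrite lee_fin addnC exprD invfM exprVn mulrA.
rewrite lee_fin; move: BN; rewrite /B ltr_pdivrMr// => /ltW BN.
have bN0 : 0 < b ^+ N by rewrite exprn_gt0.
by rewrite mulrAC ler_pdivrMr// mulrC [eps * _]mulrC mulrC.
Qed.

Lemma lebesgue_outer_chaotic :
  lebesgue_outer [set u | (0 < lambda_max (y u) F0)%E] = 0%E.
Proof.
pose E j (l : nat) := [set u | cube (l.+1%:R : R) u /\ exists N : nat, forall n, (N <= n)%N ->
    ((growth_rate j ^+ n)%:E < opnorm ('d (iter n F0) (y u)))%E].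
have E0 : lebesgue_outer (\bigcup_j \bigcup_l E j l) = 0%E.
  apply: lebesgue_outer_bigcup0 => j; apply: lebesgue_outer_bigcup0 => l.
  exact: lebesgue_outer_growth.
apply/eqP; rewrite eq_le lebesgue_outer_ge0 andbT -[leRHS]E0; apply: le_lebesgue_outer.
move=> u yu; have [j jP] := proj1 (lambda_max_gt0 (y u) FC1) yu; exists j => //.
exists (Num.truncn (\sum_i `|u ord0 i|)) => //; split=> // i.
apply/ltW; apply: le_lt_trans (truncnS_gt _).
by rewrite (bigD1 i)//= lerDl sumr_ge0.
Qed.

End NullSet.

(** * Shyness *)

Section Segment.
Context {R : realType} {X : normedModType R}.
Local Notation borel := (g_sigma_algebraType (@open X)).

Lemma continuous_borel_measurable (f : R -> X) : continuous f ->
  measurable_fun setT (f : measurableTypeR R -> borel).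
Proof.
move=> fc; apply: (@measurability _ _ (measurableTypeR R) borel setT f (@open X)) => // _ [U oU <-].
by rewrite setTI; apply: open_measurable; apply: open_comp => // s _; exact: fc.
Qed.

(** Carries the uniform law on [[0, 1]] to the segment from [0] to [v]. *)
Definition ray_map (v : X) (s : measurableTypeR R) : borel := (s : R) *: v.

Lemma ray_map_continuous v : continuous (ray_map v : R -> X).
Proof. by move=> s; apply: cvgZr_tmp; exact: cvg_id. Qed.

HB.instance Definition _ v := isMeasurableFun.Build _ _ _ _ (ray_map v)
  (continuous_borel_measurable (@ray_map_continuous v)).

(** In dimension one boxes are intervals, so countable subadditivity applies to any cover. *)
Lemma lebesgue_measure_le_outer (B : set R) : measurable B ->
  (lebesgue_measure B <= lebesgue_outer [set u : 'rV[R]_1 | B (u ord0 ord0)])%E.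
Proof.
move=> mB; apply: le_ereal_inf_tmp => _ [J [a [b [ab cover ->]]]].
pose F n : set R := if n \in J then `[a n ord0 ord0, b n ord0 ord0]%classic else set0.
have mF n : measurable (F n).
  by rewrite /F; case: ifP => _; [exact: measurable_itv|exact: measurable0].
have BF : B `<=` \bigcup_n F n.
  move=> s Bs; have /cover[n Jn /(_ ord0)] : B ((\row_(_ < 1) s) ord0 ord0) by rewrite mxE.
  by rewrite mxE => sn; exists n => //; rewrite /F mem_set //= in_itv.
apply: (le_trans (measure_sigma_subadditive (@lebesgue_measure R) mF mB BF)).
rewrite nneseries_esumT// [leRHS]esum_mkcond; apply: le_esum => n _.
rewrite /F; case: ifP => _; last by rewrite measure0.
rewrite [leLHS](lebesgue_measure_itv `[a n ord0 ord0, b n ord0 ord0]) /=.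
rewrite /box_volume big_ord1 lte_fin.
by case: ifPn => // _; rewrite lee_fin subr_ge0.
Qed.

(** The operator norm is a supremum of functions continuous in the base point, so its strict
    superlevel sets are open; the rest is countable operations. *)
Lemma borel_lambda_max_gt0 (h : X -> X) : C1_map h ->
  measurable ([set x | (0 < lambda_max x h)%E] : set borel).
Proof.
move=> hC1.
pose O j n : set X := [set x | ((growth_rate j ^+ n)%:E < opnorm ('d (iter n h) x))%E].
have oO j n : open (O j n).
  rewrite (_ : O j n = \bigcup_(v in [set v : X | `|v| <= 1])
      (fun x => `|'d (iter n h) x v|) @^-1` [set r | growth_rate j ^+ n < r]).
    apply: bigcup_open => v _; apply: open_comp; last exact: open_gt.
    by move=> x _; apply: cvg_norm; exact: continuous_diff_iter.
  apply/seteqP; split=> [x /lt_opnorm[v v1 xv]|x [v v1 xv]]; first by exists v.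
  exact: opnorm_gt xv.
rewrite (_ : [set x | _] = \bigcup_j \bigcup_N \bigcap_n
    (if (N <= n)%N then O j n else setT)); last first.
  apply/seteqP; split=> [x /(lambda_max_gt0 x hC1)[j [N jN]]|x [j _ [N _ jN]]].
    by exists j => //; exists N => // n _; case: ifP => // /jN.
  apply/(lambda_max_gt0 x hC1); exists j, N => n Nn.
  by have := jN n I; rewrite Nn.
apply: bigcupT_measurable => j; apply: bigcupT_measurable => N.
apply: bigcapT_measurable => n; case: ifP => _; last exact: measurableT.
by apply: sub_sigma_algebra; exact: oO.
Qed.

(** The law carried by the segment has compact support. A translate of [W] by [x] pulls back to the
    trace of [W] on the line through [- x], and the uniform law is dominated by Lebesgue measure. *)
Lemma shy_line (W : set X) (v : X) : measurable (W : set borel) ->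
  (forall x, lebesgue_measure [set s : R | W (x + s *: v)] = 0%E) -> shy W.
Proof.
move=> mW W0; split=> //.
exists (distribution (uniform_prob (@ltr01 R)) (ray_map v)); split.
- apply/eqP => mu0; have : 1%:E = 0%E :> \bar R.
    rewrite -mu0; apply/esym.
    exact: (probability_setT (distribution (uniform_prob (@ltr01 R)) (ray_map v))).
  by move=> /eqP; rewrite eqe oner_eq0.
- exists (ray_map v @` `[0, 1]%classic).
    apply: continuous_compact; last exact: segment_compact.
    by apply: continuous_subspaceT; exact: ray_map_continuous.
  rewrite /distribution /= /pushforward /uniform_prob integral_uniform_pdf.
  rewrite (_ : _ `&` _ = set0) ?integral_set0// -subset0 => s [/= nK s01].
  by apply: nK; exists s.
- move=> x; rewrite /distribution /= /pushforward.
  have -> : ray_map v @^-1` [set w + x | w in W] = [set s : R | W (- x + s *: v)].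
    apply/seteqP; split=> s /=.
      move=> [w Ww wE]; suff -> : - x + s *: v = w by [].
      by rewrite -[s *: v]/(ray_map v s) -wE [w + x]addrC addKr.
    by move=> Ws; exists (- x + s *: v) => //; rewrite [LHS]addrC addNKr.
  have := @dominates_uniform_prob R 0 1 ltr01.
  move=> /null_content_dominatesP; apply; last exact: W0.
  have fc : continuous (fun s : R => - x + s *: v).
    by move=> s; apply: cvgD; [exact: cvg_cst|apply: cvgZr_tmp; exact: cvg_id].
  have := continuous_borel_measurable fc.
  by move=> /(_ measurableT _ mW); rewrite setTI.
Qed.

End Segment.

(** * Integer directions in the interior of the cone *)

Section Direction.
Context {R : realType} {X : completeNormedModType R}.

Lemma interior_cone_add (C : set X) (v w : X) (r : R) :
  (forall w, `|w| <= r -> C (v + w)) -> `|w| < r -> interior C (v + w).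
Proof.
move=> rC wr; apply/nbhs_normP; exists (r - `|w|) => /=; first by rewrite subr_gt0.
move=> z /=; rewrite distrC => zw; rewrite -[z](subrK (v + w)) addrC -addrA; apply: rC.
rewrite (le_trans (ler_normD _ _))// addrC -lerBrDr ltW//.
Qed.

(* The components of a large multiple of a preimage of an interior vector are
   truncated to integers, written as differences of natural numbers. *)
Lemma integer_direction (C : set X) (d : nat) (phi : {linear 'rV[R]_d -> X})
    (u : 'rV[R]_d) : is_cone C -> interior C (phi u) ->
  exists (a : 'I_d -> nat) (T : nat), interior C
    (\sum_i (\row_i ((a i)%:R - T%:R) : 'rV[R]_d) ord0 i *: phi (delta_mx ord0 i)).
Proof.
move=> Cc uC; have [r r0 rC] := interior_coneP uC.
pose e i := phi (delta_mx ord0 i).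
have phiE (z : 'rV[R]_d) : phi z = \sum_i z ord0 i *: e i.
  by rewrite {1}[z]row_sum_delta linear_sum; apply: eq_bigr => i _; exact: linearZ.
pose S := \sum_i `|e i|.
(* Truncation moves each coordinate by at most 1, hence the image by at most [S]; after division by
   [N] this is less than [r]. *)
pose N : R := (Num.truncn (S / r)).+1%:R.
have N0 : 0 < N by [].
have SN : S / r < N by exact: truncnS_gt.
(* [T] makes all coordinates nonnegative before truncation. *)
pose T := (Num.truncn (\sum_i `|N * u ord0 i|)).+1.
have uT i : 0 <= N * u ord0 i + T%:R.
  rewrite -lerBlDr sub0r; apply: (@le_trans _ _ (- `|N * u ord0 i|)); last first.
    by rewrite lerNl -normrN ler_norm.
  rewrite lerN2; apply/ltW; apply: le_lt_trans (truncnS_gt _).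
  by rewrite (bigD1 i)//= lerDl sumr_ge0.
exists (fun i => Num.truncn (N * u ord0 i + T%:R)), T.
set p := (\row_i _ : 'rV[R]_d); rewrite -phiE.
have -> : p = N *: (u + N^-1 *: (p - N *: u)).
  by rewrite scalerDr scalerA divff ?gt_eqF// scale1r addrC subrK.
rewrite linearZ linearD /=; apply: interior_coneZ => //.
apply: interior_cone_add rC _; rewrite linearZ normrZ gtr0_norm ?invr_gt0//.
rewrite mulrC ltr_pdivrMr//; move: SN; rewrite ltr_pdivrMr// mulrC; apply: le_lt_trans.
rewrite phiE; apply: le_trans (ler_norm_sum _ _ _) _; apply: ler_sum => i _.
rewrite normrZ ler_piMl// !mxE.
have /andP[] := truncn_itv (uT i); rewrite -natr1 => t1 t2.
by rewrite ler_norml; apply/andP; split; lra.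
Qed.

End Direction.

Theorem theoremA (R : realType) (X : completeNormedModType R) (C : set X)
    (F0 : X -> X) (A : set X)
    (Xsep : separable X) (Ccone : strong_cone C)
    (Fcompact : compact_map F0) (FC1 : C1_map F0)
    (Fpos : forall x : X, strongly_positive C ('d F0 x))
    (Fdiss : pointwise_dissipative F0) (Aattr : is_attractor F0 A) :
  let S0 := [set x : X | (0 < lambda_max x F0)%E] in
  shy S0 /\
  (forall (d : nat) (phi : {linear 'rV[R]_d -> X}), bijective phi ->
     lebesgue_outer (phi @^-1` S0) = 0%E /\ ~ observable_chaos phi F0).
Proof.
move=> S0; have [Cc [v vC]] := Ccone.
have mS0 : measurable (S0 : set (g_sigma_algebraType (@open X))).
  exact: borel_lambda_max_gt0.
have outer0 (d : nat) (x0 : X) (e : 'I_d -> X) (a : 'I_d -> nat) (T : nat) :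
    interior C (\sum_i (\row_i ((a i)%:R - T%:R) : 'rV[R]_d) ord0 i *: e i) ->
    lebesgue_outer [set u | S0 (affine_chart x0 e u)] = 0%E.
  (* In the zero space an interior vector is not nonzero; there all norms vanish and no exponent is
     positive. *)
  move=> eC; have [[x xn0]|X0] := pselect (exists x : X, x != 0).
    apply: (lebesgue_outer_chaotic Cc Fcompact FC1 Fpos Aattr x0 eC).
    by apply: interior_cone_neq0 Cc eC _; exists x.
  have all0 (x : X) : x = 0 by apply: contrapT => /eqP xn0; apply: X0; exists x.
  apply/eqP; rewrite eq_le lebesgue_outer_ge0 andbT.
  apply: (@le_trans _ _ (lebesgue_outer (set0 : set 'rV[R]_d))).
    apply: le_lebesgue_outer => u /(lambda_max_gt0 _ FC1)[j [N jN]].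
    have [w _] := lt_opnorm (jN N (leqnn N)).
    rewrite (all0 ('d _ _ w)) normr0 ltNge exprn_ge0//.
    by rewrite ltW// (lt_trans ltr01)// growth_rate_gt1.
  apply: ereal_inf_lbound; exists set0, (fun=> 0), (fun=> 0); split=> //.
  by rewrite esum_set0.
split.
  apply: (shy_line (v := v)) => // x; apply/eqP; rewrite eq_le measure_ge0 andbT.
  apply: le_trans (lebesgue_measure_le_outer _) _.
    have fc : continuous (fun s : R => x + s *: v).
      by move=> s; apply: cvgD; [exact: cvg_cst|apply: cvgZr_tmp; exact: cvg_id].
    by have := continuous_borel_measurable fc measurableT mS0; rewrite setTI.
  (* The line is a one-dimensional chart whose direction [v] has the single integer component 1. *)
  have := @outer0 1%N x (fun=> v) (fun=> 1%N) 0%N.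
  rewrite big_ord1 mxE subr0 scale1r => /(_ vC) <-.
  by apply: le_lebesgue_outer => u /=; rewrite /affine_chart big_ord1.
move=> d phi [psi psiK phiK].
have phi0 : lebesgue_outer (phi @^-1` S0) = 0%E.
  (* The interior vector [v] is pulled back to coordinates and replaced by an integer direction. *)
  have [|a [T aT]] := integer_direction (phi := phi) (u := psi v) Cc.
    by rewrite phiK.
  have -> : phi @^-1` S0 =
      [set u | S0 (affine_chart 0 (fun i => phi (delta_mx ord0 i)) u)].
    apply/funext => u; rewrite /preimage /mkset /affine_chart add0r.
    congr S0; rewrite {1}[u]row_sum_delta linear_sum.
    by apply: eq_bigr => i _; exact: linearZ.
  exact: outer0 aT.
split=> // -[E [_ E0 ES]]; move: E0; rewrite ltNge -[X in (_ <= X)%E]phi0.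
by rewrite le_lebesgue_outer.
Qed.
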